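(* Let $\mathcal A$ be a Hamiltonian algebra with state space $\mathcal L$, let $\gamma(t,\rho)=\sum_{n=1}^{N}\frac1{n!}\langle\rho^{\otimes n},W^{(n)}(t)\rangle$ (with $N\le\infty$) be a uniformizable Hamiltonian functional, let $H(t,\rho)=\delta\gamma(t,\rho)$, let $\varepsilon>0$, and let $$H^{(n)}(t)=\sum_{m=1}^{n}\binom nm\varepsilon^{m-1}\,I^{(n-m)}\otimes_sW^{(m)}(t)\in\mathcal A^{(n)}$$ be its $\varepsilon$-uniformization. For a family $A^{(n)}(t)\in\mathcal A^{(n)}$, $n=0,1,2,\dots$, let $$\alpha(t,\rho)=\exp\Big\{-\frac1\varepsilon\langle\rho,I\rangle\Big\}\sum_{n=0}^\infty\frac1{n!\,\varepsilon^{n-1}}\langle\rho^{\otimes n},A^{(n)}(t)\rangle$$ be its representing functional. Then the system of abstract Heisenberg equations $$\frac{\partial A^{(n)}(t)}{\partial t}=\{H^{(n)}(t),A^{(n)}(t)\},\qquad n=0,1,2,\dots,$$ can be expressed in the form of (is equivalent to) the pseudodifferential equation $$\frac{\partial\alpha(t,\rho)}{\partial t}=\Big\langle\Big\{\overset{2}{\rho},H\big(t,\overset{2}{\rho}\cdot(I+\varepsilon\overset{1}{\delta})\big)\Big\},\overset{1}{\delta}\Big\rangle\,\alpha(t,\rho),$$ defined in terms of the symbol-Hamiltonian $H(t,\rho\cdot(I+\varepsilon A))\equiv\exp\{\varepsilon\langle\overset{2}{\rho},\overset{1}{\delta}\cdot A\rangle\}H(t,\rho)$. As $\varepsilon\to0$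 the latter equation has as its limit the first-order differential equation $$\frac{\partial}{\partial t}\alpha(t,\rho)=\langle\{\rho,H(t,\rho)\},\delta\rangle\,\alpha(t,\rho),$$ which gives the weak form of the Vlasov equation $\partial\rho(t)/\partial t=\{\rho(t),H(t,\rho(t))\}$ for $\alpha=\langle\rho(t),A\rangle$, $A\in\mathcal A$. That is, the right-hand side for the linear functional $\rho\mapsto\langle\rho,A\rangle$, evaluated at $\rho=\rho(t)$, gives $\frac{\partial}{\partial t}\langle\rho(t),A\rangle=\langle\{\rho(t),H(t,\rho(t))\},A\rangle$.
   Context: Hamiltonian algebra: a complex unital $\star$-algebra $\mathcal A$ with bilinear product $A\cdot B$ (not necessarily commutative or associative), identity $I$, and a bilinear antisymmetric bracket $\{\cdot,\cdot\}$ with $\{H,A\cdot B\}=A\cdot\{H,B\}+\{H,A\}\cdot B$. $\mathcal L$ is a real (Fréchet) space whose complexified dual is $\mathcal A$ via $\langle\rho,A\rangle$. It is assumed that the maps $A\mapsto\{H,A\}$ and $B\mapsto B\cdot A$ have preduals, i.e. there are $\{\rho,H\}$ and $\rho\cdot A$ with $\langle\{\rho,H\},A\rangle=\langle\rho,\{H,A\}\rangle$ and $\langle\rho\cdot A,B\rangle=\langle\rho,B\cdot A\rangle$. Tensor powers: $\mathcal L_n$ is the symmetric tensor power generated by the $\rho^{\otimes n}$, and $\mathcal A^{(n)}=\mathcal L_n^*$ (symmetric tensors, $\mathcal A^{(0)}=\mathbb C$), generated by the $A^{\otimes n}$ with $\langle\rho^{\otimes n},A_1\otimes\dots\otimes A_n\rangle=\prod_i\langle\rho,A_i\rangle$.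 Products in $\mathcal A^{(n)}$ are obtained by (bi)linear and weakly continuous extension from $$\Big(\bigotimes_iH_i\Big)\cdot\Big(\bigotimes_iA_i\Big)=\bigotimes_iH_i\cdot A_i,$$ $$\Big\{\bigotimes_iH_i,\bigotimes_iA_i\Big\}=\sum_{j=1}^n(H_1\cdot A_1)\otimes\dots\otimes\{H_j,A_j\}\otimes\dots\otimes(H_n\cdot A_n)$$ (the bracket in the $j$-th slot). For $n=0$ the bracket is zero. $W^{(n)}(t)\in\mathcal A^{(n)}$ are real elements, $I^{(k)}=I^{\otimes k}$, and $\otimes_s$ is the symmetrized tensor product. Terms with $m>N$ are absent. Derivatives: $\delta$ is the derivative with respect to $\rho$, $\frac{\partial}{\partial s}\alpha(\rho+s\sigma)|_{s=0}=\langle\sigma,\delta\alpha(\rho)\rangle$, and $\delta^{\otimes n}$ is the $n$-th derivative, so $\delta^{\otimes n}e^{\langle\rho,A\rangle}=e^{\langle\rho,A\rangle}A^{\otimes n}$. One has $H^{(n)}(t)=\frac1\varepsilon(1+\varepsilon\delta)^{\otimes n}\gamma(t,\rho)|_{\rho=0}$. Ordering convention: the superscripts $1,2$ give the order of application: differentiations $\overset1\delta$ first, then multiplications by $\overset2\rho$. The symbol-Hamiltonian is thus $H(t,\rho\cdot(I+\varepsilon A))=H(t,\rho+\varepsilon\rho\cdot A)$. The operator in the pseudodifferential equation is the operator $G(t,\overset2\rho,\overset1\delta)$ determined on exponentials by $$G(t,\overset2\rho,\overset1\delta)e^{\langle\rho,A\rangle}=e^{\langle\rho,A\rangle}G(t,\rho,A),\qquad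 G(t,\rho,A)=\langle\{\rho,H(t,\rho\cdot(I+\varepsilon A))\},A\rangle ,$$ i.e. $\delta$'s in the symbol act on $\alpha$ only. Functionals are treated as power series in $\rho$, and identities and limits are understood coefficientwise (each coefficient of the right-hand side is a finite sum). *)

(* Defs.v *)
From HB Require Import structures.
From mathcomp Require Import all_boot all_order all_algebra perm complex.
From mathcomp Require Import all_classical all_reals all_analysis.

Set Implicit Arguments.
Unset Strict Implicit.
Unset Printing Implicit Defensive.

Import Order.TTheory GRing.Theory Num.Theory.
Import numFieldNormedType.Exports.

Local Open Scope classical_set_scope.
Local Open Scope ring_scope.
Local Open Scope complex_scope.

(* Completeness and metrizability are stated through the neighbourhoods of 0,
   because the uniform structure carried by a [tvsType] is not required to be
   the translation-invariant one. *)
Definition frechet (R : realType) (L : tvsType R) : Prop :=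
  [/\ hausdorff_space L,
      (exists U : nat -> set L,
         (forall k, nbhs (0 : L) (U k)) /\
         (forall V, nbhs (0 : L) V -> exists k, U k `<=` V)) &
      (forall u : nat -> L,
         (forall V, nbhs (0 : L) V -> exists k, forall m n : nat,
            (k <= m)%N -> (k <= n)%N -> V (u m - u n)) ->
         exists l : L, u @ \oo --> l)].

(* The complexified dual: continuous real-linear maps to the complex numbers. *)
Definition is_cdual (R : realType) (E : tvsType R) (f : E -> R[i]) : Prop :=
  (forall (a : R) (x y : E), f (a *: x + y) = a%:C * f x + f y) /\
  continuous (f : E -> R[i]^o).

Definition cdual_pred (R : realType) (E : tvsType R) : {pred E -> R[i]} :=
  [pred f | `[< is_cdual f >]].

Record cdual (R : realType) (E : tvsType R) := CDual {
  cdual_fun :> E -> R[i];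
  cdualP : cdual_fun \in @cdual_pred R E }.

HB.instance Definition _ (R : realType) (E : tvsType R) :=
  [isSub for @cdual_fun R E].
HB.instance Definition _ (R : realType) (E : tvsType R) :=
  [Choice of cdual E by <:].

Lemma cdual_submod_closed (R : realType) (E : tvsType R) :
  GRing.submod_closed (@cdual_pred R E).
Proof.
split=> [|a f g].
  apply/asboolP; split=> [b x y|x].
    by rewrite mulr0 addr0.
  exact: cvg_cst.
rewrite !unfold_in => /asboolP[lf cf] /asboolP[lg cg]; apply/asboolP; split.
  move=> b x y.
  have E1 z : (a *: f + g) z = a * f z + g z by [].
  by rewrite !E1 lf lg !mulrDr !mulrA [b%:C * a]mulrC addrACA.
move=> x.
have -> : (a *: f + g : E -> R[i]^o) =
  (fun z => (a : R[i]^o) *: (f z : R[i]^o) + (g z : R[i]^o)) by [].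
apply: (@cvgD R[i] R[i]^o); last exact: cg.
by apply: (@cvgZr R[i] R[i]^o); exact: cf.
Qed.

HB.instance Definition _ (R : realType) (E : tvsType R) :=
  GRing.isSubmodClosed.Build R[i] (E -> R[i]) (@cdual_pred R E)
    (@cdual_submod_closed R E).
HB.instance Definition _ (R : realType) (E : tvsType R) :=
  [SubChoice_isSubLmodule of cdual E by <:].

(* The weak topology sigma(E', E) on the complexified dual. *)
HB.instance Definition _ (R : realType) (E : tvsType R) :=
  Topological.copy (cdual E)
    (initial_topology
       (fun f : cdual E => (cdual_fun f : {ptws E -> R[i]^o}))).

(* On a complexified dual this is the weak (pointwise) derivative. *)
Definition is_tderive (R : realType) (E : preTopologicalLmodType R[i])
    (f : R -> E) (t : R) (l : E) : Prop :=
  (h^-1)%:C *: (f (t + h) - f t) @[h --> 0^'] --> l.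

Definition bilinear_op (K : pzRingType) (U V W : lmodType K)
    (f : U -> V -> W) : Prop :=
  (forall a x y v, f (a *: x + y) v = a *: f x v + f y v) /\
  (forall u a x y, f u (a *: x + y) = a *: f u x + f u y).

Definition separately_continuous (U V W : topologicalType)
    (f : U -> V -> W) : Prop :=
  (forall v, continuous (fun u => f u v)) /\ (forall u, continuous (f u)).

(* Pairing of x + i y, encoded as (x, y), with an element of the dual. *)
Definition pairC (R : realType) (E : tvsType R) (z : E * E) (A : cdual E) :
  R[i] := A z.1 + 'i * A z.2.

Record hamiltonian_algebra (R : realType) (L : tvsType R) :=
  HamiltonianAlgebra {
  hmul : cdual L -> cdual L -> cdual L;
  hbr : cdual L -> cdual L -> cdual L;
  hone : cdual L;
  hstar : cdual L -> cdual L;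
  hmul_bilinear : bilinear_op hmul;
  hmul1x : forall A, hmul hone A = A;
  hmulx1 : forall A, hmul A hone = A;
  hstarE : forall A r, hstar A r = (A r)^*;
  hstarM : forall A B, hstar (hmul A B) = hmul (hstar B) (hstar A);
  hbr_bilinear : bilinear_op hbr;
  hbr_anti : forall A B, hbr A B = - hbr B A;
  hbr_leibniz : forall H A B,
    hbr H (hmul A B) = hmul A (hbr H B) + hmul (hbr H A) B;
  (* the preduals {rho, H} and rho . A; as H and A may be complex, they lie in
     the complexification of L *)
  prebr : L -> cdual L -> L * L;
  premul : L -> cdual L -> L * L;
  prebrE : forall r H A, pairC (prebr r H) A = hbr H A r;
  premulE : forall r A B, pairC (premul r A) B = hmul B A r }.

(* A system of symmetric tensor powers L_n of L: L_n is any locally convex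
   space in which the algebraic symmetric power is dense (no particular
   completion is singled out), subject to the requirement that the tensor
   operations on the duals A^(n) = L_n^* make sense.  [tens u] is the
   symmetrized tensor product of the u i, so that tens (fun=> r) is the n-th
   tensor power of r. *)
Record symmetric_powers (R : realType) (L : tvsType R) := SymmetricPowers {
  sympow :> nat -> tvsType R;
  tens : forall n, ('I_n -> L) -> sympow n;
  sympow_hausdorff : forall n, hausdorff_space (sympow n);
  tens_linear : forall n (u : 'I_n -> L) (i : 'I_n) (a : R) (x y : L),
    tens (dfwith u i (a *: x + y)) =
    a *: tens (dfwith u i x) + tens (dfwith u i y);
  tens_perm : forall n (s : {perm 'I_n}) (u : 'I_n -> L),
    tens (fun i => u (s i)) = tens u;
  tens_continuous : forall n (u : 'I_n -> L) (i : 'I_n),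
    continuous (fun x => tens (dfwith u i x));
  tens_dense : forall n, dense [set x : sympow n |
    exists k (c : 'I_k -> R) (r : 'I_k -> L),
      x = \sum_(j < k) c j *: tens (fun _ : 'I_n => r j)];
  tens1_iso : exists2 g : sympow 1 -> L, continuous g &
    cancel (fun r : L => tens (fun _ : 'I_1 => r)) g /\
    cancel g (fun r : L => tens (fun _ : 'I_1 => r));
  (* elementary tensors A_1 (x) ... (x) A_n in A^(n) *)
  etens : forall n, ('I_n -> cdual L) -> cdual (sympow n);
  etensE : forall n (A : 'I_n -> cdual L) (r : L),
    etens A (tens (fun=> r)) = \prod_(i < n) A i r;
  etens_dense : forall n, dense [set V : cdual (sympow n) |
    exists k (c : 'I_k -> R[i]) (A : 'I_k -> cdual L),
      V = \sum_(j < k) c j *: etens (fun _ : 'I_n => A j)];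
  (* the symmetrized product of A^(k) and A^(m); the equation e only spares a
     transport from A^(k + m) to A^(n) *)
  stens : forall k m n, (k + m = n)%N ->
    cdual (sympow k) -> cdual (sympow m) -> cdual (sympow n);
  stensE : forall k m n (e : (k + m = n)%N) B V (r : L),
    stens e B V (tens (fun=> r)) = B (tens (fun=> r)) * V (tens (fun=> r));
  stens_continuous : forall k m n (e : (k + m = n)%N),
    separately_continuous (stens e) }.

Arguments tens {R L} s {n} u : rename.
Arguments etens {R L} s {n} A : rename.
Arguments stens {R L} s {k m n} e B V : rename.

(* The products on A^(n).  The defining formulas are stated on the generators
   H^(x)n, A^(x)n of A^(n); by bilinearity (polarization) and separate weak
   continuity they determine the products. *)
Record tensor_products (R : realType) (L : tvsType R)
    (HA : hamiltonian_algebra L) (S : symmetric_powers L) := TensorProducts {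
  tmul : forall n, cdual (S n) -> cdual (S n) -> cdual (S n);
  tbr : forall n, cdual (S n) -> cdual (S n) -> cdual (S n);
  tmul_bilinear : forall n, bilinear_op (@tmul n);
  tmul_continuous : forall n, separately_continuous (@tmul n);
  tmulE : forall n (H A : cdual L),
    tmul (etens S (fun _ : 'I_n => H)) (etens S (fun _ : 'I_n => A)) =
    etens S (fun _ : 'I_n => hmul HA H A);
  tbr_bilinear : forall n, bilinear_op (@tbr n);
  tbr_continuous : forall n, separately_continuous (@tbr n);
  tbrE : forall n (H A : cdual L),
    tbr (etens S (fun _ : 'I_n => H)) (etens S (fun _ : 'I_n => A)) =
    \sum_(j < n) etens S (fun i : 'I_n =>
                            if i == j then hbr HA H A else hmul HA H A) }.

(* V(z, ..., z) for z = x + i y, where V is extended complex-multilinearly. *)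
Definition hpoly (R : realType) (L : tvsType R) (S : symmetric_powers L)
    (n : nat) (V : cdual (S n)) (z : L * L) : R[i] :=
  \sum_(J : {set 'I_n})
    'i ^+ #|J| * V (tens S (fun j => if j \in J then z.2 else z.1)).

(* The derivative of a functional F, at a point z of the complexification:
   d/ds F(z + s sigma) = <sigma, delta F z> at s = 0, for sigma in L.  Such an
   element of the dual is unique, and it exists for all the polynomials to
   which delta is applied below, so the default value 0 plays no role. *)
Definition delta (R : realType) (L : tvsType R) (F : L * L -> R[i])
    (z : L * L) : cdual L :=
  xget 0 [set B : cdual L | forall sigma : L,
    @is_tderive R (R[i]^o : tvsType R[i]) (fun s : R => F (z + s *: (sigma, 0))) 0 (B sigma)].

(* Formal power series sum_n <rho^(x)n, alpha n>, with the topology of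
   coefficientwise weak convergence. *)
Definition fseries (R : realType) (L : tvsType R) (S : symmetric_powers L) :=
  prod_topology (fun n => cdual (S n)).

Section Quantization.
Variables (R : realType) (L : tvsType R) (HA : hamiltonian_algebra L)
  (S : symmetric_powers L) (TP : tensor_products HA S).

Local Notation A_ n := (cdual (S n)).

(* e^<rho, A> *)
Definition exp_series (A : cdual L) : fseries S :=
  fun n => (n`!%:R)^-1 *: etens S (fun _ : 'I_n => A).

Definition mul_series (a b : fseries S) : fseries S := fun n =>
  \sum_(k < n.+1) stens S (subnK (ltn_ord k : (k <= n)%N)) (a (n - k)%N) (b k).

(* <rho, A> *)
Definition linear_series (A : cdual L) : fseries S :=
  fun n => if n == 1%N then etens S (fun _ : 'I_n => A) else 0.

(* N = None stands for N = infinity *)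
Definition in_range (N : option nat) (m : nat) : bool :=
  (0 < m)%N && (if N is Some N0 then (m <= N0)%N else true).

Definition gamma_series (N : option nat) (W : R -> forall n, A_ n) (t : R) :
    fseries S :=
  fun n => if in_range N n then (n`!%:R)^-1 *: W t n else 0.

Definition uniformization (N : option nat) (W : R -> forall n, A_ n)
    (eps t : R) (n : nat) : A_ n :=
  \sum_(m < n.+1 | in_range N m)
    ('C(n, m)%:R * eps%:C ^+ m.-1) *:
    stens S (subnK (ltn_ord m : (m <= n)%N))
      (etens S (fun _ : 'I_(n - m) => hone HA)) (W t m).

Definition representing (eps : R) (A : forall n, A_ n) : fseries S :=
  mul_series (exp_series (- (eps^-1)%:C *: hone HA))
    (fun n => (n`!%:R * eps%:C ^ (n%:Z - 1))^-1 *: A n).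

(* The part of delta alpha that is homogeneous of degree p. *)
Definition delta_series (alpha : fseries S) (p : nat) : L * L -> cdual L :=
  delta (hpoly (alpha p.+1)).

(* H(t, rho) = delta gamma(t, rho): its part of degree p, at a point of the
   complexification of L. *)
Definition Hser (N : option nat) (W : R -> forall n, A_ n) (t : R) (p : nat)
    (z : L * L) : cdual L := delta_series (gamma_series N W t) p z.

(* <rho, delta . A> with rho frozen; in its iterates all the differentiations
   precede the multiplications by rho. *)
Definition delta_dir (r : L) (A : cdual L) (F : L * L -> R[i]) :
    L * L -> R[i] := fun z => hmul HA (delta F z) A r.

(* The part of degree p + 1 in rho of the symbol
   G(t, rho, A) = <{rho, H(t, rho . (I + eps A))}, A>. *)
Definition Gsymbol N W (eps t : R) (p : nat) (r : L) (A : cdual L) : R[i] :=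
  pairC (prebr HA r (Hser N W t p (premul HA r (hone HA + eps%:C *: A)))) A.

(* G is the operator with symbol G(t, rho, A), the differentiations acting
   first: G e^<rho, A> = e^<rho, A> G(t, rho, A) degree by degree, extended
   linearly and weakly continuously. *)
Definition is_pdo N W (eps t : R) (G : fseries S -> fseries S) : Prop :=
  [/\ forall (a : R[i]) (alpha beta : fseries S) n,
        G (fun k => a *: alpha k + beta k) n = a *: G alpha n + G beta n,
      continuous G &
      forall (A : cdual L) (n : nat) (r : L),
        G (exp_series A) n (tens S (fun=> r)) =
        \sum_(p < n) exp_series A (n - p.+1)%N (tens S (fun=> r)) *
                     Gsymbol N W eps t p r A].

(* <{rho, H(t, rho)}, delta> alpha(rho): the part of degree n. *)
Definition vlasov_op N W (t : R) (alpha : fseries S) (n : nat) (r : L) : R[i] :=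
  \sum_(p < n) pairC (prebr HA r (Hser N W t p (r, 0)))
                     (delta_series alpha (n - p.+1)%N (r, 0)).

Definition heisenberg N W (eps : R) (A : R -> forall n, A_ n) : Prop :=
  forall (t : R) (n : nat),
    is_tderive (fun s => A s n) t (tbr TP (uniformization N W eps t n) (A t n)).

Definition pseudodifferential_eq (G : R -> fseries S -> fseries S)
    (alpha : R -> fseries S) : Prop :=
  forall (t : R) (n : nat),
    is_tderive (fun s => alpha s n) t (G t (alpha t) n).

End Quantization.

(* Main.v *)
Require Import Defs.
From mathcomp Require Import all_boot all_order all_algebra perm complex.
From mathcomp Require Import all_classical all_reals all_analysis.
From mathcomp Require Import ring qpoly.

Set Implicit Arguments.
Unset Strict Implicit.
Unset Printing Implicit Defensive.

Import Order.TTheory GRing.Theory Num.Theory.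
Import numFieldNormedType.Exports.

Local Open Scope classical_set_scope.
Local Open Scope ring_scope.
Local Open Scope complex_scope.

(* Multiplication by exp{-<rho, I>/eps} is invertible on power series, so the
   Heisenberg system is conjugate to an evolution equation for alpha, with a
   continuous linear generator G.  Under this conjugation e^<rho, A> corresponds
   to the family eps^-1 (I + eps A)^(x)n, and since {I, .} = 0 the bracket of
   I^(n-m) (x)_s W^(m) with C^(x)n is, on rho^(x)n,
     - m <rho, C>^(n-m) W^(m)({rho, C}, rho . C, ..., rho . C),
   where C = I + eps A; summing over n and m gives the symbol of the
   pseudodifferential operator.  A continuous linear functional vanishing on all
   e^<rho, A> is zero, hence G is the operator with that symbol.  On exponentials
   the coefficients of G are polynomials in eps whose value at eps = 0 is given
   by the Vlasov operator; interpolation in eps extends this to every alpha.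

   The argument never identifies points of the complexification of L: all that
   matters about z is the functional pairC z, because the multilinear extensions
   of continuous forms are pairings with elements of the dual in each slot. *)

(** * Pointwise convergence and the weak topology of the dual *)

Lemma prod_cvg (I : Type) (T : I -> topologicalType)
    (F : set_system (prod_topology T)) (f : prod_topology T) : Filter F ->
  (forall i, (fun g : prod_topology T => g i) @ F --> f i) -> F --> f.
Proof.
move=> FF H; apply/cvg_sup => i U [? /= [[B oB <-]]] /= Bf /filterS; apply.
by apply: H; exact: open_nbhs_nbhs.
Qed.

Section CdualTopology.
Variables (R : realType) (E : tvsType R).
Implicit Types (F : set_system (cdual E)) (f g : cdual E).

Lemma cdualD f g x : (f + g) x = f x + g x. Proof. by []. Qed.
Lemma cdualZ (a : R[i]) f x : (a *: f) x = a * f x. Proof. by []. Qed.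
Lemma cdual0 x : (0 : cdual E) x = 0. Proof. by []. Qed.
Lemma cdualN f x : (- f) x = - f x. Proof. by []. Qed.
Lemma cdual_sum (I : Type) (r : seq I) (P : pred I) (F : I -> cdual E) x :
  (\sum_(i <- r | P i) F i) x = \sum_(i <- r | P i) F i x.
Proof. by elim/big_rec2: _ => // i y1 y2 _ <-. Qed.

Lemma cdual_lin f : forall (a : R) (x y : E), f (a *: x + y) = a%:C * f x + f y.
Proof. by have /asboolP[] := cdualP f. Qed.
Lemma cdual_continuous f : continuous (f : E -> R[i]^o).
Proof. by have /asboolP[] := cdualP f. Qed.

Lemma eval_continuous x : continuous (fun f : cdual E => (f x : R[i]^o)).
Proof.
have c1 : continuous (@cdual_fun R E : cdual E -> {ptws E -> R[i]^o}).
  move=> f U; exact: (@initial_continuous (cdual E) {ptws E -> R[i]^o} (@cdual_fun R E) f U).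
have c2 := @proj_continuous E (fun=> R[i]^o) x.
by move=> f; exact: (continuous_comp (c1 f) (c2 _)).
Qed.

Lemma cdual_cvgP F f : Filter F ->
  (F --> f) <-> (forall x, (fun g : cdual E => (g x : R[i]^o)) @ F --> (f x : R[i]^o)).
Proof.
move=> FF; split=> [Ff x|H].
  by move=> U /eval_continuous; exact: Ff.
move=> U [? /= [[B oB <-]]] /= Bf /filterS; apply.
have : (@cdual_fun R E : cdual E -> {ptws E -> R[i]^o}) @ F -->
    (cdual_fun f : {ptws E -> R[i]^o}).
  by apply: prod_cvg => x; exact: H.
by apply; exact: open_nbhs_nbhs.
Qed.

Lemma cdual_contP (T : topologicalType) (h : T -> cdual E) :
  (forall x, continuous (fun t => h t x : R[i]^o)) -> continuous h.
Proof. by move=> H t; apply/cdual_cvgP => x; exact: H. Qed.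

Lemma cdual_ext f g : (forall x, f x = g x) -> f = g.
Proof. by move=> H; apply: val_inj; apply/funext. Qed.

End CdualTopology.

Lemma dense_continuous_eq (R : realType) (T : topologicalType) (D : set T) (f g : T -> R[i]^o) :
  dense D -> continuous f -> continuous g -> (forall x, D x -> f x = g x) -> f =1 g.
Proof.
move=> dD cf cg fg x; apply/eqP; apply: contrapT => /negP nfg.
pose O := [set y | f y - g y != 0].
have oO : open O.
  have -> : O = (fun y => (f y - g y : R[i]^o)) @^-1` (~` [set 0]).
    by apply/seteqP; split=> y /= /eqP.
  apply: open_comp; last first.
    apply: closed_openC; apply: accessible_closed_set1; apply: hausdorff_accessible.
    exact: norm_hausdorff.
  by move=> y _; apply: cvgB; [exact: cf | exact: cg].
have [|y [/= Oy /fg]] := dD O _ oO; first by exists x; rewrite /O /= subr_eq0.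
by move=> e; move: Oy; rewrite /O /= e subrr eqxx.
Qed.

(** * Derivatives of polynomial functions of a real variable *)

Section Poly.
Variable R : realType.
Local Notation C := (R[i]^o).

Lemma real_complex_continuous : continuous (fun x : R => (x%:C : C)).
Proof.
move=> x; apply/cvgrPdist_lt => e e0.
have e0' : 0 < complex.Re e by move: e0; rewrite ltcE /= => /andP[].
have : \forall y \near x, `|x - y| < complex.Re e.
  by apply/nbhs_ballP; exists (complex.Re e).
apply: filterS => y; rewrite -rmorphB normc_def /= expr0n /= addr0 sqrtr_sqr.
move: e0; case: e e0' => a b /= a0; rewrite ltcE /= => /andP[/eqP -> _] h.
by rewrite ltcR.
Qed.

Lemma horner_real_continuous (p : {poly R[i]}) : continuous (fun x : R => (p.[x%:C] : C)).
Proof.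
elim/poly_ind: p => [|p c IH].
  have -> : (fun x : R => (0.[x%:C] : C)) = fun=> 0 by apply/funext => x; rewrite horner0.
  exact: cst_continuous.
have -> : (fun x : R => ((p * 'X + c%:P).[x%:C] : C)) = fun x => p.[x%:C] * x%:C + c.
  by apply/funext => x; rewrite hornerMXaddC.
move=> x; apply: (@cvgD _ C); last exact: cvg_cst.
by apply: (@cvgM R[i]); [exact: IH | exact: real_complex_continuous].
Qed.

Lemma is_tderive_poly (f : R -> R[i]) (p : {poly R[i]}) :
  (forall t : R, f t = p.[t%:C]) -> @is_tderive R (R[i]^o : tvsType R[i]) f 0 (p`_1).
Proof.
move=> fp; rewrite /is_tderive.
pose q := drop_poly 1 p.
have tp : take_poly 1 p = (p`_0)%:P.
  by apply/polyP => i; rewrite coef_take_poly coefC; case: i.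
have pE x : p.[x] = p`_0 + x * q.[x].
  by rewrite -{1}(poly_take_drop 1 p) hornerD hornerM hornerXn expr1 mulrC
    tp hornerC.
have -> : p`_1 = q.[(0:R)%:C] by rewrite rmorph0 horner_coef0 coef_drop_poly.
suff : q.[h%:C] @[h --> (0:R)^'] --> (q.[(0:R)%:C] : C).
  apply: cvg_trans; apply: near_eq_cvg; near=> h.
  have h0 : h != 0 by near: h; exact: nbhs_dnbhs_neq.
  rewrite !fp add0r !pE rmorph0 mul0r addr0 addrAC subrr add0r.
  by rewrite fmorphV /GRing.scale /= mulKf // fmorph_eq0.
apply: cvg_within_filter; exact: horner_real_continuous.
Unshelve. all: by end_near. Qed.

Lemma is_tderive_unique (f : R -> R[i]) t (l l' : R[i]) :
  @is_tderive R (R[i]^o : tvsType R[i]) f t l ->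
  @is_tderive R (R[i]^o : tvsType R[i]) f t l' ->
  l = l'.
Proof. move=> h h'; have hC : hausdorff_space C by exact: norm_hausdorff.
exact: (@cvg_unique C hC _ _ l l' h h'). Qed.
End Poly.

(** * Continuity of finite complex linear combinations *)

Section ComplexContinuity.
Variables (R : realType) (T : topologicalType).
Local Notation C := (R[i]^o).

Lemma continuous_mull (c : R[i]) (f : T -> C) :
  continuous f -> continuous (fun x => (c * f x : C)).
Proof. by move=> cf x; apply: (@cvgZr R[i] C); exact: cf. Qed.

Lemma continuous_add (f g : T -> C) :
  continuous f -> continuous g -> continuous (fun x => (f x + g x : C)).
Proof. by move=> cf cg x; apply: (@cvgD _ C); [exact: cf | exact: cg]. Qed.

Lemma continuous_sum (I : Type) (r : seq I) (P : pred I) (f : I -> T -> C) :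
  (forall i, continuous (f i)) -> continuous (fun x => (\sum_(i <- r | P i) f i x : C)).
Proof.
move=> cf; elim: r => [|i r IH].
  have -> : (fun x => (\sum_(i <- [::] | P i) f i x : C)) = fun=> 0.
    by apply/funext => x; rewrite big_nil.
  exact: cst_continuous.
have -> : (fun x => (\sum_(i <- i :: r | P i) f i x : C)) =
          fun x => (if P i then 1 else 0) * f i x + \sum_(i <- r | P i) f i x.
  by apply/funext => x; rewrite big_cons; case: ifP; rewrite ?mul1r // mul0r add0r.
by apply: continuous_add; [apply: continuous_mull; exact: cf | exact: IH].
Qed.
End ComplexContinuity.

(** * Pairing of points of the complexification with the dual *)

Section Pairing.
Variables (R : realType) (L : tvsType R).
Implicit Types (x y : L) (z w : L * L) (A B : cdual L).

Lemma cdual_at0 A : A 0 = 0.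
Proof.
have := cdual_lin A 1 0 0.
rewrite scaler0 addr0 rmorph1 mul1r => /eqP.
by rewrite -subr_eq subrr => /eqP.
Qed.

Lemma cdual_addv A x y : A (x + y) = A x + A y.
Proof. by rewrite -{1}[x]scale1r cdual_lin rmorph1 mul1r. Qed.

Lemma cdual_scalev A (a : R) x : A (a *: x) = a%:C * A x.
Proof. by rewrite -[_ *: _]addr0 cdual_lin cdual_at0 addr0. Qed.

Lemma pairC_real x A : pairC (x, 0) A = A x.
Proof. by rewrite /pairC /= cdual_at0 mulr0 addr0. Qed.

Lemma pairCD z A B : pairC z (A + B) = pairC z A + pairC z B.
Proof. by rewrite /pairC !cdualD mulrDr addrACA. Qed.

Lemma pairCZ z a A : pairC z (a *: A) = a * pairC z A.
Proof. by rewrite /pairC !cdualZ mulrDr mulrCA. Qed.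

Lemma pairC0 z : pairC z (0 : cdual L) = 0.
Proof. by rewrite /pairC !cdual0 mulr0 addr0. Qed.

Lemma pairC_sum z (I : Type) (r : seq I) (P : pred I) (F : I -> cdual L) :
  pairC z (\sum_(i <- r | P i) F i) = \sum_(i <- r | P i) pairC z (F i).
Proof.
apply: (big_morph (fun A => pairC z A)); first exact: pairCD.
exact: pairC0.
Qed.

Lemma pairC_line z (t : R) x A :
  pairC (z + t *: (x, 0)) A = pairC z A + t%:C * pairC (x, 0) A.
Proof.
rewrite pairC_real /pairC /= scaler0 addr0 cdual_addv cdual_scalev.
by rewrite addrAC.
Qed.

Lemma pairC_continuous z : continuous (fun A : cdual L => pairC z A : R[i]^o).
Proof.
apply: continuous_add; first exact: eval_continuous.
by apply: continuous_mull; exact: eval_continuous.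
Qed.

End Pairing.

(** A nonzero polynomial has fewer roots than its size. This is the tool for comparing coefficients:
    identities are checked at natural values of a parameter only. *)
Lemma poly_nat_roots_eq0 (R : realType) (p : {poly R[i]}) :
  (forall n : nat, p.[n%:R] = 0) -> p = 0.
Proof.
move=> p0; apply: (@roots_geq_poly_eq0 _ p [seq k%:R | k <- iota 0 (size p)]).
- by apply/allP => _ /mapP[k _ ->]; rewrite /root p0.
- rewrite map_inj_uniq ?iota_uniq // => m n /eqP.
  by rewrite eqr_nat => /eqP.
- by rewrite size_map size_iota.
Qed.

Lemma perm_cons_cat (T : eqType) (x : T) s t : perm_eq (x :: s ++ t) (s ++ x :: t).
Proof. exact: permEl (perm_catCA [:: x] s t). Qed.

(** * Symmetric multilinear forms on the complexification, and polarization *)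

Section SymmetricForms.
Variables (R : realType) (L : tvsType R).
Local Notation C := (R[i]).
Local Notation LC := (L * L)%type.
Implicit Types (d : seq LC -> C) (s t : seq LC).

(* The list holds the n arguments.  The representation by some B encodes
   complex-linearity and continuity in the first argument; by symmetry they hold
   in every argument. *)
Definition symform n d :=
  (forall s t, size s = n -> perm_eq s t -> d s = d t) /\
  (forall s, (size s).+1 = n -> exists B : cdual L, forall z, d (z :: s) = pairC z B).

(** The binomial theorem for [z = a + t b], by induction on the number of copies of [z]. The
    relation is required only under pairings: [t] is complex while [L * L] is a real space, and the
    preduals are known only through their pairings. *)
Lemma symform_binom n d (z a b : LC) (t : C) s m :
  symform n d -> (size s + m)%N = n ->
  (forall B : cdual L, pairC z B = pairC a B + t * pairC b B) ->
  d (s ++ nseq m z) =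
  \sum_(k < m.+1) 'C(m, k)%:R * t ^+ k * d (s ++ nseq k b ++ nseq (m - k) a).
Proof.
move=> [dP dL] sn zab; elim: m s sn => [|m IH] s sn.
  by rewrite big_ord1 /= bin0 expr0 !mul1r.
have szs w : size (s ++ nseq m w) = n.-1.
  by rewrite size_cat size_nseq -sn addnS.
have n0 : (0 < n)%N by rewrite -sn addnS.
have hd w : d (s ++ w :: nseq m z) = d ((w :: s) ++ nseq m z).
  apply: dP; first by rewrite size_cat /= size_nseq.
  by rewrite -cat1s perm_catCA.
have hd' w : (size (w :: s) + m)%N = n by rewrite /= addSnnS.
have [B BE] := dL (s ++ nseq m z) (etrans (congr1 S (szs z)) (prednK n0)).
rewrite /= hd /= BE zab -!BE -!cat_cons !IH //.
pose e k := d (s ++ nseq k b ++ nseq (m.+1 - k) a).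
have ea (k : 'I_m.+1) : d ((a :: s) ++ nseq k b ++ nseq (m - k) a) = e k.
  have km : (k <= m)%N by rewrite -ltnS.
  apply: dP; first by rewrite /= !size_cat !size_nseq subnKC // -sn addnS.
  by rewrite subSn //= -cat1s -[a :: nseq _ _]cat1s perm_catCA perm_cat2l perm_catCA.
have eb (k : 'I_m.+1) : d ((b :: s) ++ nseq k b ++ nseq (m - k) a) = e k.+1.
  have km : (k <= m)%N by rewrite -ltnS.
  apply: dP; first by rewrite /= !size_cat !size_nseq subnKC // -sn addnS.
  by rewrite subSS /= -cat1s -[b :: (nseq _ _ ++ _)]cat1s perm_catCA.
rewrite (eq_bigr (fun k : 'I_m.+1 => 'C(m, k)%:R * t ^+ k * e k)); last
  by move=> k _; rewrite ea.
rewrite [X in _ + t * X](eq_bigr (fun k : 'I_m.+1 => 'C(m, k)%:R * t ^+ k * e k.+1)); last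
  by move=> k _; rewrite eb.
rewrite -[RHS]/(\sum_(k < m.+2) 'C(m.+1, k)%:R * t ^+ k * e k).
rewrite [RHS]big_ord_recl [in LHS]big_ord_recl /= !bin0 !expr0 !mul1r -addrA; congr (_ + _).
(* With the terms for [k = 0] split off, Pascal's rule separates the right-hand side into the two
   sums on the left. *)
rewrite [in RHS](eq_bigr (fun i : 'I_m.+1 => 
    'C(m, i.+1)%:R * t ^+ i.+1 * e i.+1 + 'C(m, i)%:R * t ^+ i.+1 * e i.+1)); last first.
  by move=> i _; rewrite /bump /= add1n binS natrD -!mulrDl.
rewrite big_split /=; congr (_ + _).
  rewrite [RHS]big_ord_recr /= bin_small // !mul0r addr0.
  by apply: eq_bigr => i _; rewrite /bump /= add1n.
rewrite mulr_sumr; apply: eq_bigr => i _; rewrite exprS; ring.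
Qed.

(** Zero on real diagonals gives zero on real arguments by extracting the linear coefficient along
    [x + k y], one argument at a time. Complex arguments follow since a dual element that vanishes
    on [L] pairs to 0 with every point. *)
Lemma symform_polarization n d :
  symform n d -> (forall x : L, d (nseq n (x, 0)) = 0) ->
  forall s, size s = n -> d s = 0.
Proof.
move=> dS d0; have [dP dL] := dS.
have real (u : seq L) m x : (size u + m)%N = n ->
    d ([seq (y, 0) | y <- u] ++ nseq m (x, 0)) = 0.
  elim: u m x => [|y u IH] m x un; first by rewrite add0n in un; rewrite un; exact: d0.
  pose s := [seq (y, 0 : L) | y <- u].
  have sm : (size s + m.+1)%N = n by rewrite size_map -addSnnS.
  (* At a natural number [k], [p] takes the value of [d] with [x + k y] in the last [m.+1] slots,
     which is 0 by induction. Its linear coefficient is [m.+1] times the value sought. *)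
  pose p := \poly_(k < m.+2) ('C(m.+1, k)%:R * d (s ++ nseq k (y, 0) ++ nseq (m.+1 - k) (x, 0))).
  suff : p`_1 = 0.
    rewrite coef_poly /= bin1 subn1 /= => /eqP.
    rewrite mulf_eq0 pnatr_eq0 /= => /eqP h; rewrite -[RHS]h.
    apply: dP; first by rewrite /= size_cat size_map size_nseq.
    by rewrite /= -cat1s -[_ :: nseq _ _]cat1s perm_catCA.
  rewrite (_ : p = 0) ?coef0 //; apply: poly_nat_roots_eq0 => k.
  rewrite horner_poly -[RHS](IH m.+1 (x + k%:R *: y)); last by rewrite -sm size_map.
  rewrite (symform_binom (t := k%:R) (a := (x, 0)) (b := (y, 0)) dS); last 2 first.
  - by rewrite -sm.
  - by move=> B; rewrite !pairC_real cdual_addv cdual_scalev rmorph_nat.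
  by apply: eq_bigr => i _; rewrite mulrAC.
(* The arguments in [u] have already been made real; those in [s] are still complex. *)
suff H s (u : seq L) : (size s + size u)%N = n -> d (s ++ [seq (y, 0) | y <- u]) = 0.
  by move=> s sn; rewrite -[s]cats0; apply: (H s [::]); rewrite addn0.
elim: s u => [|[x y] s IH] u un.
  have := real u 0%N 0; rewrite cats0 addn0 => -> //.
have [|B BE] := dL (s ++ [seq (y, 0) | y <- u]).
  by rewrite size_cat size_map -un.
have BE0 w : B w = 0.
  rewrite -pairC_real -BE -[RHS](IH (w :: u)) ?addnS -?un //.
  apply: dP; first by rewrite /= size_cat size_map.
  by rewrite /= -cat1s -[_ :: map _ _]cat1s perm_catCA.
by rewrite cat_cons BE /pairC !BE0 mulr0 addr0.
Qed.

Lemma symform_sub n d d' : symform n d -> symform n d' -> symform n (fun s => d s - d' s).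
Proof.
move=> [dP dL] [dP' dL']; split=> [s t sn st|s sn].
  by rewrite (dP s t) // (dP' s t).
have [B BE] := dL s sn; have [B' BE'] := dL' s sn.
exists (B + (-1) *: B') => z; rewrite BE BE' pairCD pairCZ; ring.
Qed.

Lemma symform_prod n (B : cdual L) : symform n (fun s => \prod_(z <- s) pairC z B).
Proof.
split=> [s t _ st|s _]; first exact: perm_big.
exists ((\prod_(z <- s) pairC z B) *: B) => z.
by rewrite big_cons pairCZ mulrC.
Qed.

Variable S : symmetric_powers L.

(** The complex-multilinear extension of [V]: after expansion of each argument [x + i y], [J]
    collects the slots in which the imaginary part is taken. On the diagonal it is [hpoly]. *)
Definition mext n (V : cdual (S n)) s : C :=
  \sum_(J : {set 'I_n}) 'i ^+ #|J| *
    V (tens S (fun j : 'I_n => if j \in J then (nth 0 s j).2 else (nth 0 s j).1)).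

Lemma hpolyE n (V : cdual (S n)) z : hpoly V z = mext V (nseq n z).
Proof.
apply: eq_bigr => J _; congr (_ * V (tens S _)); apply/funext => j.
by rewrite nth_nseq ltn_ord.
Qed.

Lemma mext_sym n (V : cdual (S n)) s t : size s = n -> perm_eq s t -> mext V s = mext V t.
Proof.
move=> sn st; have tn : size t == n by rewrite -(perm_size st) sn.
have /tuple_permP[p sE] : perm_eq s (Tuple tn) by [].
(* A permutation of the arguments permutes the subsets [J] and keeps their cardinality. *)
rewrite [RHS](reindex_inj (imset_inj (@perm_inj _ p))) /=.
apply: eq_bigr => J _; rewrite card_imset; last exact: perm_inj.
congr (_ * _); rewrite -[in RHS](tens_perm S p); congr (V (tens S _)); apply/funext => j.
rewrite mem_imset; last exact: perm_inj.
have -> : nth 0 s j = nth 0 t (p j); last by [].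
rewrite sE -[RHS](tnth_nth 0 (Tuple tn)).
by rewrite -(tnth_nth 0 [tuple tnth (Tuple tn) (p i) | i < n]) tnth_mktuple.
Qed.

Lemma slot_cdual n (V : cdual (S n)) (u : 'I_n -> L) (i : 'I_n) :
  (fun x => V (tens S (dfwith u i x))) \in @cdual_pred R L.
Proof.
apply/asboolP; split=> [a x y|x]; first by rewrite tens_linear cdual_lin.
have c1 : continuous (fun x => tens S (dfwith u i x)) by exact: tens_continuous.
have c2 : continuous (V : S n -> R[i]^o) by exact: cdual_continuous.
exact: (continuous_comp (c1 x) (c2 _)).
Qed.

Definition slot n (V : cdual (S n)) (u : 'I_n -> L) (i : 'I_n) : cdual L :=
  CDual (slot_cdual V u i).

(** Each [J] without the first slot is matched with [ord0 |: J]. The two terms differ by a factor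
    ['i] and by the part of [z] that enters, which is the shape of [pairC z]. *)
Lemma mext_head n (V : cdual (S n)) s :
  (size s).+1 = n -> exists B : cdual L, forall z, mext V (z :: s) = pairC z B.
Proof.
case: n V => // n V [sn].
(* The leading 0 is a placeholder, overwritten by [slot]. *)
pose u (J : {set 'I_n.+1}) (j : 'I_n.+1) :=
  if j \in J then (nth 0 (0 :: s) j).2 else (nth 0 (0 :: s) j).1.
exists (\sum_(J : {set 'I_n.+1} | ord0 \notin J) 'i ^+ #|J| *: slot V (u J) ord0) => z.
rewrite /mext (bigID (fun J : {set 'I_n.+1} => ord0 \in J)) /= addrC.
rewrite pairC_sum.
rewrite [X in _ + X](reindex_onto (fun J => ord0 |: J) (fun J => J :\ ord0)) /=; last first.
  by move=> J J0; rewrite finset.setD1K.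
rewrite [X in _ + X](eq_bigl (fun J : {set 'I_n.+1} => ord0 \notin J)); last first.
  move=> J; rewrite finset.setU11 /=; apply/eqP/idP => [<-|J0]; first by rewrite finset.setD11.
  by rewrite finset.setU1K.
rewrite -big_split /=; apply: eq_bigr => J J0.
rewrite pairCZ /pairC mulrDr; congr (_ * _ + _).
  rewrite /slot /=; congr (V (tens S _)); apply/funext => j.
  case: (eqVneq ord0 j) => [<-|j0]; first by rewrite dfwithin (negbTE J0).
  rewrite dfwithout // /u; case: (unliftP ord0 j) j0 => [k ->|-> /eqP//] _.
  by rewrite /= /bump.
rewrite finset.cardsU1 J0 add1n exprSr -mulrA; congr (_ * (_ * V (tens S _))).
apply/funext => j.
case: (eqVneq ord0 j) => [<-|j0]; first by rewrite dfwithin finset.setU11.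
rewrite dfwithout // /u finset.in_setU1 eq_sym (negbTE j0) /=.
by case: (unliftP ord0 j) j0 => [k ->|-> /eqP//].
Qed.

Lemma symform_mext n (V : cdual (S n)) : symform n (mext V).
Proof. by split; [exact: mext_sym | exact: mext_head]. Qed.

Lemma mext_real n (V : cdual (S n)) x : mext V (nseq n (x, 0)) = V (tens S (fun=> x)).
Proof.
rewrite /mext (bigD1 finset.set0) //= cards0 expr0 mul1r big1 ?addr0.
  by congr (V (tens S _)); apply/funext => j; rewrite finset.in_set0 nth_nseq ltn_ord.
move=> J /set0Pn[i iJ].
set u := (X in tens S X); suff -> : tens S u = 0 by rewrite cdual_at0 mulr0.
(* A slot in [J] carries the zero imaginary part, so linearity in that slot makes the tensor equal
   to its double. *)
have uE : dfwith u i 0 = u.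
  apply/funext => j.
  case: (eqVneq i j) => [<-|ij]; last by rewrite dfwithout.
  by rewrite dfwithin /u iJ nth_nseq ltn_ord.
have := tens_linear S u i 1 0 0; rewrite scaler0 addr0 uE scale1r => /eqP.
by rewrite -subr_eq subrr => /eqP.
Qed.

(** Both sides are symmetric forms that agree on real diagonals, so polarization applies to their
    difference. *)
Lemma mext_etens n (B : cdual L) s :
  size s = n -> mext (etens S (fun _ : 'I_n => B)) s = \prod_(z <- s) pairC z B.
Proof.
move=> sn; apply/eqP; rewrite -subr_eq0; apply/eqP.
apply: (symform_polarization (symform_sub (symform_mext _) (symform_prod n B))) sn => x.
by rewrite mext_real etensE prodr_const card_ord big_nseq pairC_real iter_mulr_1 subrr.
Qed.

Lemma mextD n (V W : cdual (S n)) s : mext (V + W) s = mext V s + mext W s.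
Proof. by rewrite -big_split; apply: eq_bigr => J _; rewrite mulrDr. Qed.

Lemma mextZ n a (V : cdual (S n)) s : mext (a *: V) s = a * mext V s.
Proof. by rewrite mulr_sumr; apply: eq_bigr => J _; rewrite cdualZ mulrCA. Qed.

Lemma mext_continuous n s : continuous (fun V : cdual (S n) => mext V s : C^o).
Proof.
apply: continuous_sum => J; apply: continuous_mull; exact: eval_continuous.
Qed.

End SymmetricForms.

(** * The derivative [delta], the symbol-Hamiltonian and the Vlasov operator *)

Section Delta.
Variables (R : realType) (L : tvsType R) (S : symmetric_powers L).
Local Notation C := (R[i]).

Lemma delta_eq (F : L * L -> C) z (B : cdual L) :
  (forall x : L, @is_tderive R (R[i]^o : tvsType R[i])
     (fun t : R => F (z + t *: (x, 0))) 0 (B x)) -> delta F z = B.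
Proof.
move=> FB; rewrite /delta; case: xgetP => [B' _ FB'|/(_ B)//].
by apply: cdual_ext => x; exact: is_tderive_unique (FB' x) (FB x).
Qed.

Lemma delta_const (c : C) z : delta (fun _ : L * L => c) z = 0.
Proof.
apply: delta_eq => x; rewrite cdual0.
have -> : (0 : C) = (c%:P)`_1 by rewrite coefC.
by apply: is_tderive_poly => t; rewrite hornerC.
Qed.

Lemma delta_symform n (d : seq (L * L) -> C) (c : C) s m z w :
  symform n d -> (size s + m.+1)%N = n ->
  pairC w (delta (fun z' => c * d (s ++ nseq m.+1 z')) z) =
  c * m.+1%:R * d (w :: s ++ nseq m z).
Proof.
move=> dS sn; have [dP dL] := dS.
have [|B BE] := dL (s ++ nseq m z); first by rewrite size_cat size_nseq -addnS.
rewrite BE -pairCZ; congr (pairC w _); apply: delta_eq => x.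
pose p := \poly_(k < m.+2)
  (c * 'C(m.+1, k)%:R * d (s ++ nseq k (x, 0) ++ nseq (m.+1 - k) z)).
have -> : ((c * m.+1%:R) *: B) x = p`_1.
  rewrite cdualZ -pairC_real -BE coef_poly /= bin1 subn1 /=; congr (_ * _).
  apply: dP; first by rewrite /= size_cat size_nseq -addnS.
  exact: perm_cons_cat.
apply: is_tderive_poly => t.
rewrite horner_poly (symform_binom (t := t%:C) (a := z) (b := (x, 0)) dS sn); last first.
  by move=> A; rewrite pairC_line.
by rewrite mulr_sumr; apply: eq_bigr => k _; ring.
Qed.

Lemma pairC_delta_series (alpha : fseries S) p z w :
  pairC w (delta_series alpha p z) = p.+1%:R * mext (alpha p.+1) (w :: nseq p z).
Proof.
rewrite /delta_series.
have -> : hpoly (alpha p.+1) = fun z' => 1 * mext (alpha p.+1) ([::] ++ nseq p.+1 z').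
  by apply/funext => z'; rewrite mul1r hpolyE.
by rewrite (delta_symform _ _ _ (symform_mext _)) // mul1r.
Qed.

Variable HA : hamiltonian_algebra L.

Lemma pairC_premul r A B : pairC (premul HA r A) B = hmul HA B A r.
Proof. exact: premulE. Qed.

Lemma pairC_prebr r A B : pairC (prebr HA r A) B = hbr HA A B r.
Proof. exact: prebrE. Qed.

Lemma hmul_line r (a : C) A B :
  hmul HA B (hone HA + a *: A) r = B r + a * hmul HA B A r.
Proof.
have [_ H] := hmul_bilinear HA.
by rewrite addrC H hmulx1 cdualD cdualZ addrC.
Qed.

Variables (N : option nat) (W : R -> forall n, cdual (S n)).

(** Each application turns one copy of [z] into the predual of right multiplication by [A], and
    contributes one factor of the falling factorial. *)
Lemma iter_delta_dir t p r A (x : L) k :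
  iter k (delta_dir HA r A) (fun z => Hser N W t p z x) =
  fun z => (p ^_ k)%:R * (p.+1%:R * mext (gamma_series N W t p.+1)
             ((x, 0) :: nseq k (premul HA r A) ++ nseq (p - k) z)).
Proof.
elim: k => [|k IH]; apply/funext => z.
  by rewrite /= ffactn0 mul1r subn0 -pairC_real pairC_delta_series.
rewrite iterS IH /delta_dir -pairC_premul.
(* When [p <= k] no copy of [z] is left: the derivative of a constant is 0, and so is the next
   falling factorial. *)
have [kp|pk] := ltnP k p; last first.
  have /eqP -> : (p - k == 0)%N by rewrite subn_eq0.
  by rewrite /= delta_const pairC0 ffact_small ?mul0r.
rewrite -(subnSK kp).
under [X in delta X]eq_fun do rewrite mulrA -cat_cons.
rewrite (delta_symform _ _ _ (symform_mext _)); last first.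
  by rewrite /= size_nseq addSn subnSK // subnKC // ltnW.
rewrite subnSK // ffactnSr natrM -!mulrA; congr (_ * _).
rewrite mulrCA; congr (_ * (_ * _)).
apply: (mext_sym); last first.
  exact: (perm_cons_cat _ [:: _]).
by rewrite /= size_cat !size_nseq -addnS subnSK // subnKC // ltnW.
Qed.

(** Under pairings, [premul HA r] of [I + eps A] is the real point [r] plus [eps] times
    [premul HA r A]. The binomial expansion is then the exponential series, since a binomial
    coefficient is a falling factorial over [k!]; terms beyond [p] vanish. *)
Lemma symbol_hamiltonian eps t p r A (x : L) K : (p <= K)%N ->
  Hser N W t p (premul HA r (hone HA + eps%:C *: A)) x =
  \sum_(k < K.+1) eps%:C ^+ k / k`!%:R *
    iter k (delta_dir HA r A) (fun z => Hser N W t p z x) (r, 0).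
Proof.
move=> pK; rewrite -pairC_real pairC_delta_series -cat1s.
rewrite (symform_binom (t := eps%:C) (a := (r, 0)) (b := premul HA r A)
  (symform_mext _)) //; last first.
  by move=> B; rewrite pairC_real !pairC_premul hmul_line.
rewrite mulr_sumr; under [RHS]eq_bigr do rewrite iter_delta_dir.
rewrite (big_ord_widen_cond K.+1 predT (fun k => p.+1%:R * ('C(p, k)%:R * eps%:C ^+ k *
   mext (gamma_series N W t p.+1) ([:: (x, 0)] ++
     nseq k (premul HA r A) ++ nseq (p - k) (r, 0))))) //=.
rewrite big_mkcond /=; apply: eq_bigr => k _; case: ifPn => [_|]; last first.
  by rewrite -leqNgt => pk; rewrite ffact_small // mul0r mulr0.
rewrite -bin_ffact natrM; set f := k`!%:R; set X := mext _ _.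
have f0 : f != 0 by rewrite pnatr_eq0 -lt0n fact_gt0.
have fK : f^-1 * f = 1 by rewrite mulVf.
transitivity (f^-1 * f * (p.+1%:R * ('C(p, k)%:R * eps%:C ^+ k * X))); first by rewrite fK mul1r.
ring.
Qed.

Lemma vlasov_opE t alpha n r :
  vlasov_op HA N W t alpha n r =
  \sum_(p < n) (n - p.+1).+1%:R * mext (alpha (n - p.+1).+1)
    (prebr HA r (Hser N W t p (r, 0)) :: nseq (n - p.+1) (r, 0)).
Proof. by apply: eq_bigr => p _; rewrite pairC_delta_series. Qed.

Lemma vlasov_op_linear t (A : cdual L) p r :
  vlasov_op HA N W t (linear_series S A) p.+1 r =
  pairC (prebr HA r (Hser N W t p (r, 0))) A.
Proof.
rewrite vlasov_opE big_ord_recr /= big1 => [|q _].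
  by rewrite add0r subnn mul1r /linear_series /= mext_etens // big_seq1.
(* For [q < p] the coefficient involved has degree at least 2, where [linear_series] is 0. *)
rewrite subSS /linear_series; case: eqP => [[e]|_].
  by have := ltn_ord q; rewrite -subn_gt0; rewrite e.
by rewrite -(scale0r 0) mextZ mul0r mulr0.
Qed.

Lemma hbr_anti_at A B r : hbr HA A B r = - hbr HA B A r.
Proof. by rewrite hbr_anti cdualN. Qed.

(** Antisymmetry turns the pairing of the bracket of [r] and [H] with [A] into a weakly continuous
    functional of [H], which commutes with the limit of the partial sums. *)
Lemma vlasov_series (A : cdual L) t r (H : cdual L) :
  series (fun p => Hser N W t p (r, 0)) @ \oo --> H ->
  (series (fun n => vlasov_op HA N W t (linear_series S A) n r) : nat -> R[i]^o) @ \oo -->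
  (pairC (prebr HA r H) A : R[i]^o).
Proof.
(* The degree 0 term is an empty sum, hence the shift by one. *)
move=> cH; rewrite -(cvg_shiftS (series _)).
have -> : [sequence series (fun n => vlasov_op HA N W t (linear_series S A) n r) n.+1]_n =
  (fun B => - pairC (prebr HA r A) B : R[i]^o) \o series (fun p => Hser N W t p (r, 0)).
  apply/funext => n; rewrite /= /series /= big_nat_recl // {1}/vlasov_op big_ord0 add0r.
  rewrite pairC_sum -sumrN; apply: eq_bigr => p _.
  by rewrite vlasov_op_linear !pairC_prebr -hbr_anti_at.
rewrite pairC_prebr hbr_anti_at -pairC_prebr.
apply: cvg_comp; first exact: cH.
by apply: (@cvgN _ R[i]^o); exact: pairC_continuous.
Qed.
End Delta.

(** * Elementary consequences of linearity *)

Section LinearMaps.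
Variables (K : pzRingType) (U V : lmodType K) (f : U -> V).
Hypothesis fl : forall a x y, f (a *: x + y) = a *: f x + f y.

Lemma lin_map0 : f 0 = 0.
Proof.
have := fl 1 0 0; rewrite scaler0 addr0 scale1r => /eqP.
by rewrite -subr_eq subrr => /eqP.
Qed.

Lemma lin_mapD x y : f (x + y) = f x + f y.
Proof. by rewrite -[x]scale1r fl !scale1r. Qed.

Lemma lin_mapZ a x : f (a *: x) = a *: f x.
Proof. by rewrite -[_ *: _]addr0 fl lin_map0 addr0. Qed.

Lemma lin_map_sum (I : Type) (r : seq I) (P : pred I) (F : I -> U) :
  f (\sum_(i <- r | P i) F i) = \sum_(i <- r | P i) f (F i).
Proof. by apply: (big_morph f); [exact: lin_mapD | exact: lin_map0]. Qed.
End LinearMaps.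

(** * Density of tensor powers, and the bracket on tensors *)

Section Density.
Variables (R : realType) (L : tvsType R) (S : symmetric_powers L).
Local Notation C := (R[i]).

Lemma diag_ext n (V V' : cdual (S n)) :
  (forall r, V (tens S (fun=> r)) = V' (tens S (fun=> r))) -> V = V'.
Proof.
move=> VV; apply: cdual_ext.
apply: (dense_continuous_eq (@tens_dense _ _ S n)); [exact: cdual_continuous..|].
move=> _ [k [c [r ->]]].
elim/big_rec: _ => [|j x _ xE]; first by rewrite !cdual_at0.
by rewrite !cdual_lin xE VV.
Qed.

Lemma etens_dense_eq n (f g : cdual (S n) -> C) :
  (forall a (V V' : cdual (S n)), f (a *: V + V') = a * f V + f V') ->
  (forall a (V V' : cdual (S n)), g (a *: V + V') = a * g V + g V') ->
  continuous (f : _ -> R[i]^o) -> continuous (g : _ -> R[i]^o) ->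
  (forall A, f (etens S (fun=> A)) = g (etens S (fun=> A))) -> f =1 g.
Proof.
move=> fl gl cf cg fg.
apply: (dense_continuous_eq (@etens_dense _ _ S n)); [exact: cf | exact: cg | ].
move=> _ [k [c [r ->]]].
elim/big_rec: _ => [|j x _ xE]; last by rewrite fl gl xE fg.
by rewrite (@lin_map0 _ _ C^o f fl) (@lin_map0 _ _ C^o g gl).
Qed.

Lemma stens_linear k m n (e : (k + m = n)%N) (B : cdual (S k)) (a : C) (V V' : cdual (S m)) :
  stens S e B (a *: V + V') = a *: stens S e B V + stens S e B V'.
Proof.
by apply: diag_ext => r; rewrite cdualD cdualZ !stensE cdualD cdualZ mulrDr mulrCA.
Qed.

Lemma etens_diag n (A : cdual L) r :
  etens S (fun _ : 'I_n => A) (tens S (fun=> r)) = A r ^+ n.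
Proof. by rewrite etensE prodr_const card_ord. Qed.

Lemma etens_binom n (A B : cdual L) (t : C) :
  etens S (fun _ : 'I_n => A + t *: B) =
  \sum_(m < n.+1) ('C(n, m)%:R * t ^+ m) *:
    stens S (subnK (ltn_ord m : (m <= n)%N))
      (etens S (fun _ : 'I_(n - m) => A)) (etens S (fun _ : 'I_m => B)).
Proof.
apply: diag_ext => r; rewrite etens_diag cdualD cdualZ exprDn cdual_sum.
apply: eq_bigr => m _; rewrite cdualZ stensE !etens_diag exprMn -mulr_natl; ring.
Qed.

Variables (HA : hamiltonian_algebra L) (TP : tensor_products HA S).

(** The Leibniz rule for [I = I . I] makes the bracket equal to its double. *)
Lemma hbr_one A : hbr HA A (hone HA) = 0.
Proof.
have := hbr_leibniz HA A (hone HA) (hone HA).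
rewrite !hmul1x hmulx1 => /eqP; rewrite -subr_eq subrr => /eqP.
by [].
Qed.

Lemma tbr_etens_diag n (A B : cdual L) r :
  tbr TP (etens S (fun _ : 'I_n => A)) (etens S (fun _ : 'I_n => B)) (tens S (fun=> r)) =
  n%:R * hbr HA A B r * hmul HA A B r ^+ n.-1.
Proof.
rewrite tbrE cdual_sum (eq_bigr (fun=> hbr HA A B r * hmul HA A B r ^+ n.-1)).
  by rewrite sumr_const card_ord -[LHS]mulr_natl mulrA.
move=> j _; rewrite etensE (bigD1 j) //= eqxx; congr (_ * _).
rewrite (eq_bigr (fun=> hmul HA A B r)) => [|i /negbTE -> //].
by rewrite prodr_const cardC1 card_ord.
Qed.

(* Compare the coefficients of t^m in {(I + t B)^(x)n, A^(x)n}. *)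
Lemma tbr_stens_etens n m (mn : (m <= n)%N) (A B : cdual L) r :
  tbr TP (stens S (subnK mn) (etens S (fun=> hone HA)) (etens S (fun=> B)))
    (etens S (fun _ : 'I_n => A)) (tens S (fun=> r)) =
  m%:R * A r ^+ (n - m) * hbr HA B A r * hmul HA B A r ^+ m.-1.
Proof.
have [tl _] := tbr_bilinear TP n; have [hl _] := hmul_bilinear HA.
have [bl _] := hbr_bilinear HA.
pose X (k : 'I_n.+1) := tbr TP (stens S (subnK (ltn_ord k : (k <= n)%N))
  (etens S (fun=> hone HA)) (etens S (fun=> B)))
    (etens S (fun _ : 'I_n => A)) (tens S (fun=> r)).
pose a := A r; pose b := hmul HA B A r; pose y := hbr HA B A r.
(* The bracket with the power of [I + t B] is computed in two ways: by expanding the power, and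
   directly. In the latter, [I] drops out of the bracket but not out of the product. *)
have H (t : C) : \sum_(k < n.+1) 'C(n, k)%:R * t ^+ k * X k = n%:R * (t * y) * (a + t * b) ^+ n.-1.
  have <- : hbr HA (hone HA + t *: B) A r = t * y.
    by rewrite addrC bl cdualD cdualZ [hbr _ (hone HA) A]hbr_anti hbr_one oppr0 addr0.
  have <- : hmul HA (hone HA + t *: B) A r = a + t * b.
    by rewrite addrC hl cdualD cdualZ hmul1x addrC.
  rewrite -tbr_etens_diag etens_binom (lin_map_sum (fun c x z => tl c x z _)) cdual_sum.
  by apply: eq_bigr => k _; rewrite (lin_mapZ (fun c x z => tl c x z _)) cdualZ.
pose p := \sum_(k < n.+1) ('C(n, k)%:R * X k) *: 'X^k -
   (n%:R * y)%:P * 'X * (a%:P + b%:P * 'X) ^+ n.-1.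
have p0 : p = 0.
  apply: poly_nat_roots_eq0 => k; apply/eqP.
  rewrite hornerD hornerN horner_sum subr_eq0; apply/eqP.
  transitivity (\sum_(i < n.+1) 'C(n, i)%:R * k%:R ^+ i * X i).
    by apply: eq_bigr => i _; rewrite hornerZ hornerXn mulrAC.
  rewrite H hornerM hornerM horner_exp hornerD hornerM !hornerC !hornerX [b * _]mulrC; ring.
have mn1 : (m < n.+1)%N by [].
pose mo := Ordinal mn1.
have XE : X mo = m%:R * a ^+ (n - m) * y * b ^+ m.-1; last first.
  rewrite -/a -/b -/y -XE /X /=; congr (tbr TP (stens S _ _ _) _ _).
  exact: eq_irrelevance.
have : p`_m = 0 by rewrite p0 coef0.
rewrite coefB coef_sum (bigD1 mo) //= coefZ coefXn eqxx mulr1 big1 ?addr0; last first.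
  move=> i im; rewrite coefZ coefXn (_ : _ == _ = false) ?mulr0 //.
  by apply/negbTE; rewrite eq_sym.
move/eqP; rewrite subr_eq0 => /eqP E.
have c0 : 'C(n, m)%:R != 0 :> C by rewrite pnatr_eq0 -lt0n bin_gt0.
apply: (mulfI c0); rewrite E {E p p0 H}.
(* For [m = 0] the coefficient vanishes because of the factor ['X]. *)
case: m mn mn1 @mo c0 => [|m] mn mn1 mo c0.
  by rewrite -mulrA coefCM coefXM mulr0 !mul0r mulr0.
rewrite -mulrA coefCM coefXM /= exprDn coef_sum.
have n0 : (0 < n)%N by exact: leq_ltn_trans mn.
have mn2 : (m < n.-1.+1)%N by rewrite prednK.
rewrite (bigD1 (Ordinal mn2)) //= big1 ?addr0; last first.
  move=> i im; rewrite coefMn exprMn -!polyC_exp !coefCM coefXn.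
  by rewrite (_ : _ == _ = false) ?mulr0 ?mul0rn //; apply/negbTE; rewrite eq_sym.
rewrite coefMn exprMn -!polyC_exp !coefCM coefXn eqxx mulr1.
have -> : (n.-1 - m = n - m.+1)%N by rewrite -[in RHS](prednK n0) subSS.
rewrite -[_ *+ 'C(_, _)]mulr_natl.
(* Absorption identity, which releases the binomial coefficient cancelled above. *)
have E : n%:R * 'C(n.-1, m)%:R = 'C(n, m.+1)%:R * m.+1%:R :> C.
  rewrite -!natrM; congr (_%:R); rewrite [RHS]mulnC.
  exact: mul_bin_diag.
transitivity (n%:R * 'C(n.-1, m)%:R * (y * (a ^+ (n - m.+1) * b ^+ m))); first ring.
rewrite E; ring.
Qed.

(** Both sides are linear and weakly continuous in [V], so tensor powers suffice. The sign arises
    because pairing [prebr HA r A] with [B] gives the bracket of [A] with [B], in the opposite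
    order. *)
Lemma tbr_stens n m (mn : (m <= n)%N) (A : cdual L) (V : cdual (S m)) r :
  tbr TP (stens S (subnK mn) (etens S (fun=> hone HA)) V)
    (etens S (fun _ : 'I_n => A)) (tens S (fun=> r)) =
  - (m%:R * A r ^+ (n - m) * mext V (prebr HA r A :: nseq m.-1 (premul HA r A))).
Proof.
have [tl _] := tbr_bilinear TP n.
have [tc _] := tbr_continuous TP n.
have [_ sc] := stens_continuous S (subnK mn).
move: V; apply: etens_dense_eq => [a V V'|a V V'| | |B].
- by rewrite stens_linear tl cdualD cdualZ.
- rewrite mextD mextZ; ring.
- move=> V; have c1 := sc (etens S (fun=> hone HA)) V.
  have c2 := tc (etens S (fun=> A)) (stens S (subnK mn) (etens S (fun=> hone HA)) V).
  have c3 := @eval_continuous R (S n) (tens S (fun=> r)).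
  exact: (continuous_comp c1 (continuous_comp c2 (c3 _))).
- have -> : (fun V : cdual (S m) => - (m%:R * A r ^+ (n - m) *
      mext V (prebr HA r A :: nseq m.-1 (premul HA r A)))) =
    fun V => (- (m%:R * A r ^+ (n - m))) * mext V (prebr HA r A :: nseq m.-1 (premul HA r A)).
    by apply/funext => V; rewrite mulNr.
  apply: continuous_mull; exact: mext_continuous.
rewrite tbr_stens_etens; case: m mn {sc} => [|m] mn; first by rewrite !mul0r oppr0.
rewrite mext_etens /= ?size_nseq // big_cons big_nseq iter_mulr_1 pairC_prebr pairC_premul.
by rewrite hbr_anti_at; ring.
Qed.

End Density.

(** * Cauchy products of scalar sequences *)

Section Cauchy.
Variable K : numFieldType.
Implicit Types u v w : nat -> K.

Definition cauchy u v n := \sum_(k < n.+1) u (n - k)%N * v k.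

Lemma eq_cauchy n u v u' v' :
  (forall k, (k <= n)%N -> u k = u' k) -> (forall k, (k <= n)%N -> v k = v' k) ->
  cauchy u v n = cauchy u' v' n.
Proof.
move=> uu vv; apply: eq_bigr => k _.
by rewrite uu ?leq_subr // vv // -ltnS ltn_ord.
Qed.

(** Truncation above degree [n] does not affect coefficient [n], so associativity can be inherited
    from polynomials. *)
Lemma cauchy_coef N u v n : (n < N)%N ->
  cauchy u v n = ((\poly_(i < N) u i) * (\poly_(i < N) v i))`_n.
Proof.
move=> nN; rewrite coefMr; apply: eq_bigr => k _.
have kN : (k < N)%N by exact: leq_trans (ltn_ord k) nN.
by rewrite !coef_poly kN (leq_ltn_trans (leq_subr _ _) nN).
Qed.

Lemma cauchyA u v w n : cauchy u (cauchy v w) n = cauchy (cauchy u v) w n.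
Proof.
pose P f : {poly K} := \poly_(i < n.+1) f i.
transitivity ((P u * (P v * P w))`_n).
  rewrite coefMr; apply: eq_bigr => k _; rewrite coef_poly ltnS leq_subr.
  by rewrite (cauchy_coef _ _ (ltn_ord k)).
rewrite mulrA coefMr; apply: eq_bigr => k _; rewrite coef_poly ltn_ord.
by rewrite (@cauchy_coef n.+1) // ltnS leq_subr.
Qed.

Definition expseq (a : K) n := (n`!%:R)^-1 * a ^+ n.

Lemma cauchy_exp a b n : cauchy (expseq a) (expseq b) n = expseq (a + b) n.
Proof.
rewrite /expseq exprDn mulr_sumr; apply: eq_bigr => k _ /=.
have kn : (k <= n)%N by rewrite -ltnS.
have nf m : m`!%:R != 0 :> K by rewrite pnatr_eq0 -lt0n fact_gt0.
have E : n`!%:R = 'C(n, k)%:R * k`!%:R * (n - k)`!%:R :> K.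
  by rewrite -!natrM -mulnA bin_fact.
have c0 : 'C(n, k)%:R != 0 :> K by rewrite pnatr_eq0 -lt0n bin_gt0.
rewrite E -[_ *+ 'C(n, k)]mulr_natr; field.
by rewrite c0 !nf.
Qed.

Lemma cauchy_exp0 u n : cauchy (expseq 0) u n = u n.
Proof.
rewrite /cauchy big_ord_recr /= subnn /expseq expr0 fact0 invr1 !mul1r big1 ?add0r // => k _.
by rewrite expr0n subn_eq0 leqNgt ltn_ord mulr0 mul0r.
Qed.

Lemma cauchy_expK a u n : cauchy (expseq a) (cauchy (expseq (- a)) u) n = u n.
Proof.
rewrite cauchyA -[RHS]cauchy_exp0; apply: eq_cauchy => // k _.
by rewrite cauchy_exp subrr.
Qed.

End Cauchy.

(** * Continuity of the operations on formal series *)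

Section ContinuousSeries.
Variables (R : realType) (T : topologicalType).

Lemma continuous_eval_comp (E : tvsType R) (f : T -> cdual E) x :
  continuous f -> continuous (fun t => f t x : R[i]^o).
Proof.
move=> cf t; have c := @eval_continuous R E x.
exact: (continuous_comp (cf t) (c _)).
Qed.

Lemma continuous_cdualZ (E : tvsType R) (c : R[i]) (f : T -> cdual E) :
  continuous f -> continuous (fun t => c *: f t).
Proof.
move=> cf; apply: cdual_contP => x; apply: continuous_mull.
exact: continuous_eval_comp.
Qed.

Lemma continuous_cdual_sum (E : tvsType R) (I : Type) (r : seq I) (P : pred I)
    (f : I -> T -> cdual E) :
  (forall i, continuous (f i)) -> continuous (fun t => \sum_(i <- r | P i) f i t).
Proof.
move=> cf; apply: cdual_contP => x.
under eq_fun do rewrite cdual_sum.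
apply: continuous_sum => i.
exact: continuous_eval_comp.
Qed.

Variables (L : tvsType R) (S : symmetric_powers L).

Lemma continuous_mul_series (a : fseries S) (f : T -> fseries S) :
  (forall n, continuous (fun t => f t n)) ->
  forall n, continuous (fun t => mul_series a (f t) n).
Proof.
move=> cf n; apply: continuous_cdual_sum => k t.
have [_ c] := stens_continuous S (subnK (ltn_ord k : (k <= n)%N)).
exact: (continuous_comp (cf k t) (c (a (n - k)%N) (f t k))).
Qed.
End ContinuousSeries.

Lemma fseries_proj_continuous (R : realType) (L : tvsType R) (S : symmetric_powers L) n :
  continuous (fun alpha : fseries S => alpha n).
Proof. exact: (@proj_continuous nat (fun n => cdual (S n)) n). Qed.

(** * Continuous linear forms on formal series, and totality of the exponentials *)

Section Uniqueness.
Variables (R : realType) (L : tvsType R) (S : symmetric_powers L).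
Local Notation C := (R[i]).

Lemma exp_series_diag (A : cdual L) n r :
  exp_series S A n (tens S (fun=> r)) = expseq (A r) n.
Proof. by rewrite /exp_series cdualZ etens_diag. Qed.

Lemma mul_series_diag (a b : fseries S) n r :
  mul_series a b n (tens S (fun=> r)) =
  cauchy (fun n => a n (tens S (fun=> r))) (fun n => b n (tens S (fun=> r))) n.
Proof. by rewrite /mul_series cdual_sum; apply: eq_bigr => k _; rewrite stensE. Qed.

Variable phi : fseries S -> C.
Hypothesis philin : forall a (x y : fseries S),
  phi (fun k => a *: x k + y k) = a * phi x + phi y.
Hypothesis phicont : continuous (phi : fseries S -> R[i]^o).

Lemma linear_form0 : phi (fun=> 0) = 0.
Proof.
have := philin 1 (fun=> 0) (fun=> 0).
have -> : (fun k => 1 *: (0 : cdual (S k)) + 0) = (fun k => 0) :> fseries S.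
  by apply: functional_extensionality_dep => k; rewrite scaler0 addr0.
by rewrite mul1r => /eqP; rewrite -subr_eq subrr => /eqP.
Qed.

(** Otherwise there are series [b K], zero below degree [K], on which [phi] is 1. They tend to 0
    coefficientwise, against continuity. *)
Lemma linear_form_tail : exists K, forall x : fseries S,
  (forall k, (k < K)%N -> x k = 0) -> phi x = 0.
Proof.
apply: contrapT => /forallNP H.
have H' K : exists x : fseries S, (forall k, (k < K)%N -> x k = 0) /\ phi x = 1.
  have /existsNP[x /not_implyP[x0 /eqP px]] := H K.
  (* The summand 0 gives the shape required by [philin]. *)
  exists (fun k => (phi x)^-1 *: x k + 0); split.
    by move=> k /x0 ->; rewrite scaler0 addr0.
  by rewrite philin linear_form0 addr0 mulVf.
have /choice[b bP] := H'.
have cb : b @ \oo --> ((fun=> 0) : fseries S).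
  apply: prod_cvg => i; apply: cvg_near_cst.
  by exists i.+1 => // K /= iK; case: (bP K) => + _; apply.
have : (phi \o b : nat -> R[i]^o) @ \oo --> (phi (fun=> 0) : R[i]^o).
  by apply: (@cvg_comp _ _ _ b (phi : _ -> R[i]^o) _ _ _ cb); exact: phicont.
rewrite linear_form0.
have -> : (phi \o b : nat -> R[i]^o) = fun=> 1 by apply/funext => K; case: (bP K).
have hC : hausdorff_space (R[i]^o : topologicalType) by exact: norm_hausdorff.
move=> h; have h1 : (fun _ : nat => (1 : R[i]^o)) @ \oo --> (1 : R[i]^o) by exact: cvg_cst.
have e : (0 : C) = 1 := @cvg_unique _ hC _ _ _ _ h h1.
by have := oner_neq0 C; rewrite -e eqxx.
Qed.

Let single n (V : cdual (S n)) : fseries S := dfwith (fun k => 0 : cdual (S k)) n V.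

Lemma single_in n V : @single n V n = V.
Proof. exact: dfwithin. Qed.

Lemma single_out n V k : n != k -> @single n V k = 0.
Proof. exact: dfwithout. Qed.

Lemma linear_form_single n a (V V' : cdual (S n)) :
  phi (single (a *: V + V')) = a * phi (single V) + phi (single V').
Proof.
rewrite -philin; congr phi; apply: functional_extensionality_dep => k.
have [<-|nk] := eqVneq n k; first by rewrite !single_in.
by rewrite !single_out // scaler0 addr0.
Qed.

Lemma linear_form_single_continuous n :
  continuous (fun V : cdual (S n) => phi (single V) : R[i]^o).
Proof.
move=> V.
have c : continuous (@single n).
  exact: (@dfwith_continuous nat (fun n => cdual (S n)) (fun k => 0) n).
by apply: (@cvg_comp _ _ _ (@single n) (phi : _ -> R[i]^o) _ _ _ (c V)); exact: phicont.
Qed.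

Lemma linear_form_trunc j (x : fseries S) :
  phi (fun k => if (k < j)%N then x k else 0) = \sum_(k < j) phi (single (x k)).
Proof.
elim: j => [|j IH]; first by rewrite big_ord0 -linear_form0.
rewrite big_ord_recr /= -IH addrC -[phi (single _)]mul1r -philin; congr phi.
apply: functional_extensionality_dep => k; rewrite scale1r ltnS.
have [<-|nk] := eqVneq j k; first by rewrite single_in leqnn ltnn addr0.
by rewrite single_out // add0r leq_eqVlt eq_sym (negbTE nk).
Qed.

Lemma linear_form_sum : exists K, (forall x, phi x = \sum_(k < K) phi (single (x k))) /\
  forall k, (K <= k)%N -> forall V : cdual (S k), phi (single V) = 0.
Proof.
have [K KP] := linear_form_tail; exists K; split=> [x|k Kk V]; last first.
  by apply: KP => l lK; apply: single_out; rewrite neq_ltn (leq_trans lK Kk) orbT.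
rewrite -linear_form_trunc; apply/eqP; rewrite -subr_eq0 addrC -mulN1r -philin; apply/eqP.
by apply: KP => k kK; rewrite kK scaleN1r addNr.
Qed.

Lemma exp_seriesZ (t : C) (A : cdual L) n :
  exp_series S (t *: A) n = t ^+ n *: exp_series S A n.
Proof.
by apply: diag_ext => r; rewrite cdualZ !exp_series_diag /expseq cdualZ exprMn mulrCA.
Qed.

Hypothesis phiexp : forall A, phi (exp_series S A) = 0.

(** On the exponential of [m A], [phi] is a polynomial in [m], because it sees finitely many
    degrees. It vanishes at all natural [m], so each homogeneous part is killed, and tensor powers
    are weakly dense in each degree. *)
Lemma exp_series_total (x : fseries S) : phi x = 0.
Proof.
have [K [Ksum Kz]] := linear_form_sum.
suff H k (V : cdual (S k)) : phi (single V) = 0 by rewrite Ksum big1.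
have [kK|/Kz//] := ltnP k K.
have z0 n : phi (@single n 0) = 0.
  rewrite -linear_form0; congr phi; apply: functional_extensionality_dep => l.
  by have [<-|nl] := eqVneq n l; rewrite ?single_in ?single_out.
have zZ n a (U : cdual (S n)) : phi (single (a *: U)) = a * phi (single U).
  by rewrite -[a *: U]addr0 linear_form_single z0 addr0.
move: V; apply: etens_dense_eq => [|a V V'| | |A].
- exact: linear_form_single.
- by rewrite mulr0 addr0.
- exact: linear_form_single_continuous.
- exact: cst_continuous.
pose p := \poly_(l < K) phi (single (exp_series S A l)).
have p0 : p = 0.
  apply: poly_nat_roots_eq0 => m; rewrite horner_poly -[RHS](phiexp (m%:R *: A)) Ksum.
  by apply: eq_bigr => l _; rewrite mulrC exp_seriesZ [RHS]zZ.
have : p`_k = 0 by rewrite p0 coef0.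
rewrite coef_poly kK /exp_series zZ => /eqP; rewrite mulf_eq0 invr_eq0 pnatr_eq0.
by rewrite -[_ == 0%N]negbK -lt0n fact_gt0 => /eqP.
Qed.
End Uniqueness.

(** * The Heisenberg system conjugated to an evolution of representing functionals *)

Section Representation.
Variables (R : realType) (L : tvsType R) (HA : hamiltonian_algebra L)
  (S : symmetric_powers L) (TP : tensor_products HA S).
Variables (N : option nat) (W : R -> forall n, cdual (S n)).
Local Notation C := (R[i]).

Definition repcoef (eps : R) n : C := (n`!%:R * eps%:C ^ (n%:Z - 1))^-1.

Lemma repcoef_neq0 eps n : 0 < eps -> repcoef eps n != 0.
Proof.
move=> e0; rewrite invr_eq0 mulf_neq0 ?pnatr_eq0 -?lt0n ?fact_gt0 //.
by apply: expfz_neq0; rewrite fmorph_eq0 gt_eqF.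
Qed.

(** The inverse passage to [representing]: multiplication by the exponential of [I / eps], then
    removal of the weights [repcoef]. *)
Definition unrep (eps : R) (alpha : fseries S) : fseries S := fun n =>
  (repcoef eps n)^-1 *: mul_series (exp_series S ((eps^-1)%:C *: hone HA)) alpha n.

Lemma representing_diag eps (F : forall n, cdual (S n)) n r :
  representing HA eps F n (tens S (fun=> r)) =
  cauchy (expseq (- ((eps^-1)%:C * hone HA r)))
    (fun k => repcoef eps k * F k (tens S (fun=> r))) n.
Proof.
rewrite mul_series_diag; apply: eq_cauchy => k _ //.
by rewrite exp_series_diag cdualZ mulNr.
Qed.

Lemma unrep_diag eps alpha n r : unrep eps alpha n (tens S (fun=> r)) =
  (repcoef eps n)^-1 * cauchy (expseq ((eps^-1)%:C * hone HA r))
    (fun k => alpha k (tens S (fun=> r))) n.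
Proof.
rewrite cdualZ mul_series_diag; congr (_ * _); apply: eq_cauchy => k _ //.
by rewrite exp_series_diag cdualZ.
Qed.

Lemma representingK eps (F : forall n, cdual (S n)) n : 0 < eps ->
  unrep eps (representing HA eps F) n = F n.
Proof.
move=> e0; apply: diag_ext => r; rewrite unrep_diag.
rewrite (@eq_cauchy _ _ _ _ _ _ (fun _ _ => erefl) (fun k _ => representing_diag eps F k r)).
by rewrite cauchy_expK mulKf // repcoef_neq0.
Qed.

Lemma mul_series_lin (a : fseries S) c (x y : fseries S) n :
  mul_series a (fun k => c *: x k + y k) n = c *: mul_series a x n + mul_series a y n.
Proof.
rewrite scaler_sumr -big_split; apply: eq_bigr => k _; exact: stens_linear.
Qed.

Lemma representing_lin eps c (x y : fseries S) n :
  representing HA eps (fun k => c *: x k + y k) n =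
  c *: representing HA eps x n + representing HA eps y n.
Proof.
rewrite /representing -mul_series_lin; apply: (congr1 (fun z : fseries S => mul_series _ z n)).
apply: functional_extensionality_dep => k.
by rewrite scalerDr !scalerA mulrC.
Qed.

Lemma unrep_lin eps c (x y : fseries S) n :
  unrep eps (fun k => c *: x k + y k) n = c *: unrep eps x n + unrep eps y n.
Proof. by rewrite /unrep mul_series_lin scalerDr !scalerA mulrC. Qed.

Lemma representing_continuous eps n :
  continuous (fun F : fseries S => representing HA eps F n).
Proof.
apply: continuous_mul_series => k; apply: continuous_cdualZ; exact: fseries_proj_continuous.
Qed.

Lemma unrep_continuous eps n : continuous (fun alpha : fseries S => unrep eps alpha n).
Proof.
apply: continuous_cdualZ; apply: continuous_mul_series => k; exact: fseries_proj_continuous.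
Qed.

Definition heisenberg_rhs eps t (F : fseries S) : fseries S :=
  fun n => tbr TP (uniformization HA N W eps t n) (F n).

Definition heisenberg_pdo eps t (alpha : fseries S) : fseries S :=
  representing HA eps (heisenberg_rhs eps t (unrep eps alpha)).

Lemma heisenberg_rhs_lin eps t c (x y : fseries S) n :
  heisenberg_rhs eps t (fun k => c *: x k + y k) n =
  c *: heisenberg_rhs eps t x n + heisenberg_rhs eps t y n.
Proof. by have [_ H] := tbr_bilinear TP n; apply: H. Qed.

Lemma heisenberg_pdo_lin eps t c (x y : fseries S) n :
  heisenberg_pdo eps t (fun k => c *: x k + y k) n =
  c *: heisenberg_pdo eps t x n + heisenberg_pdo eps t y n.
Proof.
rewrite -representing_lin; apply: (congr1 (fun z : fseries S => representing HA eps z n)).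
apply: functional_extensionality_dep => k.
rewrite -heisenberg_rhs_lin; apply: (congr1 (fun z : fseries S => heisenberg_rhs eps t z k)).
by apply: functional_extensionality_dep => l; rewrite unrep_lin.
Qed.

Lemma heisenberg_pdo_continuous eps t : continuous (heisenberg_pdo eps t).
Proof.
move=> alpha; apply: prod_cvg => [|n].
  by apply: fmap_filter; exact: nbhs_filter.
move: alpha.
apply: continuous_mul_series => k; apply: continuous_cdualZ => alpha.
have [_ c] := tbr_continuous TP k.
apply: (@cvg_comp _ _ _ (fun alpha => unrep eps alpha k)
  (tbr TP (uniformization HA N W eps t k))); first exact: unrep_continuous.
exact: c.
Qed.

Lemma pairC_Hser t p z w :
  pairC w (Hser N W t p z) =
  if in_range N p.+1 then p.+1%:R / p.+1`!%:R * mext (W t p.+1) (w :: nseq p z) else 0.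
Proof.
rewrite pairC_delta_series /gamma_series; case: ifP => _; first by rewrite mextZ mulrA.
by rewrite -(scale0r 0) mextZ mul0r mulr0.
Qed.

(** Antisymmetry moves the bracket from the Hamiltonian to [A], so that [W] is evaluated as a
    multilinear form with [prebr HA r A] in one slot. *)
Lemma GsymbolE eps t p r A :
  Gsymbol HA N W eps t p r A =
  if in_range N p.+1 then - (p.+1%:R / p.+1`!%:R *
    mext (W t p.+1) (prebr HA r A :: nseq p (premul HA r (hone HA + eps%:C *: A)))) else 0.
Proof.
rewrite /Gsymbol pairC_prebr hbr_anti_at -pairC_prebr pairC_Hser.
by case: ifP => // _; rewrite oppr0.
Qed.

Lemma hbr_line (r : L) eps A B :
  hbr HA (hone HA + eps *: A) B r = eps * hbr HA A B r.
Proof.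
have [bl _] := hbr_bilinear HA.
by rewrite addrC bl cdualD cdualZ [hbr _ (hone HA) _]hbr_anti hbr_one oppr0 addr0.
Qed.

Lemma repcoefE eps n : 0 < eps ->
  repcoef eps n = (n`!%:R)^-1 * (eps%:C * (eps%:C)^-1 ^+ n).
Proof.
move=> e0; have E0 : eps%:C != 0 :> C by rewrite fmorph_eq0 gt_eqF.
rewrite /repcoef invfM; congr (_ * _).
by rewrite expfzDr // -exprnP exprN1 invfM invrK exprVn mulrC.
Qed.

Lemma unrep_exp eps A n : 0 < eps ->
  unrep eps (exp_series S A) n =
  (eps%:C)^-1 *: etens S (fun=> hone HA + eps%:C *: A).
Proof.
move=> e0; have E0 : eps%:C != 0 :> C by rewrite fmorph_eq0 gt_eqF.
apply: diag_ext => r; rewrite unrep_diag cdualZ etens_diag cdualD cdualZ.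
rewrite (@eq_cauchy _ _ _ _ _ (expseq (A r)) (fun _ _ => erefl)); last first.
  by move=> k _; rewrite exp_series_diag.
rewrite cauchy_exp repcoefE // /expseq fmorphV.
have -> : (eps%:C)^-1 * hone HA r + A r = (eps%:C)^-1 * (hone HA r + eps%:C * A r) :> C.
  by rewrite mulrDr mulKf.
rewrite exprMn; set v := (eps%:C)^-1 ^+ n; set c := _ ^+ n; set f : C := n`!%:R.
have v0 : v != 0 by rewrite expf_neq0 // invr_eq0.
have f0 : f != 0 by rewrite pnatr_eq0 -lt0n fact_gt0.
field.
by rewrite E0 v0 f0.
Qed.

(** The symbol indexed by its degree [m = p.+1] in [r], with value 0 at [m = 0], so that it can
    enter Cauchy products. *)
Definition symbol_coef eps t A r (m : nat) : C :=
  if in_range N m then - (m%:R / m`!%:R *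
    mext (W t m) (prebr HA r A :: nseq m.-1 (premul HA r (hone HA + eps%:C *: A)))) else 0.

Lemma mext_prebr_line m (V : cdual (S m)) r (c : C) A s : (size s).+1 = m ->
  mext V (prebr HA r (hone HA + c *: A) :: s) = c * mext V (prebr HA r A :: s).
Proof.
move=> sm; have [B BE] := mext_head V sm.
by rewrite !BE !pairC_prebr hbr_line.
Qed.

(** The factorials in [repcoef] and in the binomial coefficients of the uniformization recombine
    into the exponential of [I / eps + A] times the symbol. *)
Lemma heisenberg_rhs_exp eps t A r n : 0 < eps ->
  repcoef eps n * heisenberg_rhs eps t (unrep eps (exp_series S A)) n (tens S (fun=> r)) =
  cauchy (expseq ((eps^-1)%:C * hone HA r + A r)) (symbol_coef eps t A r) n.
Proof.
move=> e0; have E0 : eps%:C != 0 :> C by rewrite fmorph_eq0 gt_eqF.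
have [tl tr] := tbr_bilinear TP n.
rewrite /heisenberg_rhs unrep_exp // (lin_mapZ (tr _)) cdualZ /uniformization.
rewrite (lin_map_sum (fun a x y => tl a x y _)) cdual_sum mulrA mulr_sumr.
rewrite /cauchy [LHS]big_mkcond /=; apply: eq_bigr => m _.
rewrite /symbol_coef; case: ifPn => [rm|_]; last by rewrite mulr0.
rewrite (lin_mapZ (fun a x y => tl a x y _)) cdualZ tbr_stens.
case: m rm => -[|m] mn // rm.
rewrite [Ordinal _ : nat]/= -![m.+1.-1]/m; have mn' : (m < n)%N by rewrite -ltnS.
rewrite mext_prebr_line ?size_nseq // repcoefE // /expseq.
have cE : (hone HA + eps%:C *: A) r = hone HA r + eps%:C * A r by [].
rewrite cE [(eps^-1)%:C]fmorphV.
have -> : (eps%:C)^-1 * hone HA r + A r = (eps%:C)^-1 * (hone HA r + eps%:C * A r) :> C.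
  by rewrite mulrDr mulKf.
set X := mext _ _; set c := hone HA r + _; rewrite exprMn.
have nf k : k`!%:R != 0 :> C by rewrite pnatr_eq0 -lt0n fact_gt0.
have fE : n`!%:R = 'C(n, m.+1)%:R * m.+1`!%:R * (n - m.+1)`!%:R :> C.
  by rewrite -!natrM -mulnA bin_fact.
have c0 : 'C(n, m.+1)%:R != 0 :> C by rewrite pnatr_eq0 -lt0n bin_gt0.
(* Of the [n] inverse powers, [n - m.+1] belong to the exponential, [m] cancel the weight in the
   uniformization, and the last cancels the [eps] coming from the bracket with [I + eps A]. *)
have vE : (eps%:C)^-1 ^+ n = (eps%:C)^-1 ^+ (n - m.+1) * ((eps%:C)^-1 ^+ m * (eps%:C)^-1) :> C.
  by rewrite -exprSr -exprD subnK.
rewrite fE vE [(_ ^-1) ^+ m]exprVn.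
have Em0 : eps%:C ^+ m != 0 :> C by rewrite expf_neq0.
move: (nf m.+1) (nf (n - m.+1)%N) c0 Em0.
set f1 := (m.+1)`!%:R; set f2 := (n - m.+1)`!%:R; set b := 'C(_, _)%:R; set em := _ ^+ m.
set v := _ ^+ (n - m.+1); set ck := c ^+ _; set m1 := m.+1%:R.
move=> f10 f20 b0 em0; field.
by rewrite E0 f10 f20 b0 em0.
Qed.

Lemma symbol_coefS eps t A r p : symbol_coef eps t A r p.+1 = Gsymbol HA N W eps t p r A.
Proof. by rewrite GsymbolE. Qed.

Lemma heisenberg_pdo_exp eps t A n r : 0 < eps ->
  heisenberg_pdo eps t (exp_series S A) n (tens S (fun=> r)) =
  \sum_(p < n) exp_series S A (n - p.+1)%N (tens S (fun=> r)) *
     Gsymbol HA N W eps t p r A.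
Proof.
move=> e0; rewrite representing_diag.
under [RHS]eq_bigr do rewrite exp_series_diag.
rewrite (@eq_cauchy _ _ _ _ _ _ (fun _ _ => erefl)
  (fun k _ => heisenberg_rhs_exp t A r k e0)) cauchyA.
(* The two exponentials of [I / eps] cancel and leave that of [A]. *)
rewrite (@eq_cauchy _ _ _ _ (expseq (A r)) _ _ (fun _ _ => erefl)); last first.
  by move=> k _; rewrite cauchy_exp addKr.
rewrite /cauchy big_ord_recl {1}/symbol_coef /in_range /= mulr0 add0r.
by apply: eq_bigr => p _; rewrite symbol_coefS.
Qed.

Lemma heisenberg_pdoP eps t : 0 < eps -> is_pdo HA N W eps t (heisenberg_pdo eps t).
Proof.
move=> e0; split=> [a x y n| |A n r].
- exact: heisenberg_pdo_lin.
- exact: heisenberg_pdo_continuous.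
- exact: heisenberg_pdo_exp.
Qed.

Lemma pdo_diag_continuous eps t G n r : is_pdo HA N W eps t G ->
  continuous (fun x : fseries S => G x n (tens S (fun=> r)) : R[i]^o).
Proof.
move=> [_ Gc _]; apply: continuous_eval_comp => x.
apply: (@cvg_comp _ _ _ G (fun y : fseries S => y n) _ _ _ (Gc x)).
exact: fseries_proj_continuous.
Qed.

Lemma pdo_diag_lin eps t G n r : is_pdo HA N W eps t G ->
  forall a (x y : fseries S), G (fun k => a *: x k + y k) n (tens S (fun=> r)) =
    a * G x n (tens S (fun=> r)) + G y n (tens S (fun=> r)).
Proof. by move=> [Gl _ _] a x y; rewrite Gl cdualD cdualZ. Qed.

(** Each coefficient of the difference, evaluated on a diagonal tensor, is a continuous linear form
    that vanishes on exponentials. *)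
Lemma pdo_unique eps t G G' : is_pdo HA N W eps t G -> is_pdo HA N W eps t G' -> G = G'.
Proof.
move=> GP GP'; apply/funext => x; apply: functional_extensionality_dep => n.
apply: diag_ext => r; apply/eqP; rewrite -subr_eq0 -mulN1r; apply/eqP.
pose phi (x : fseries S) := G x n (tens S (fun=> r)) + (-1) * G' x n (tens S (fun=> r)).
apply: (@exp_series_total _ _ S phi) => [a y z| |A]; rewrite /phi.
- rewrite (pdo_diag_lin _ _ GP) (pdo_diag_lin _ _ GP'); ring.
- apply: continuous_add; first exact: pdo_diag_continuous GP.
  by apply: continuous_mull; exact: pdo_diag_continuous GP'.
- by case: GP GP' => [_ _ ->] [_ _ ->]; rewrite mulN1r subrr.
Qed.

Lemma is_tderive_comp (f : R -> fseries S) t (l : fseries S) m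
    (Phi : fseries S -> cdual (S m)) :
  (forall a (x y : fseries S), Phi (fun k => a *: x k + y k) = a *: Phi x + Phi y) ->
  continuous Phi -> (forall n, is_tderive (fun s => f s n) t (l n)) ->
  is_tderive (fun s => Phi (f s)) t (Phi l).
Proof.
move=> Pl Pc fl.
(* The difference quotients of all coefficients converge jointly in the product topology, and
   linearity lets [Phi] pass through them. *)
pose q h : fseries S := fun k => (h^-1)%:C *: (f (t + h) k - f t k).
have ql : q h @[h --> (0 : R)^'] --> l by apply: prod_cvg => k; exact: fl.
have : Phi (q h) @[h --> (0 : R)^'] --> Phi l by apply: (cvg_comp _ _ ql); exact: Pc.
apply: cvg_trans; apply: near_eq_cvg; near=> h.
have h0 : h%:C != 0 :> C.
  by rewrite fmorph_eq0; near: h; exact: nbhs_dnbhs_neq.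
have -> : f (t + h) = fun k => h%:C *: q h k + f t k.
  apply: functional_extensionality_dep => k.
  by rewrite /q fmorphV scalerA mulfV // scale1r subrK.
by rewrite Pl addrK fmorphV scalerA mulVf // scale1r.
Unshelve. all: by end_near. Qed.

(** By uniqueness [G t] is the conjugated Heisenberg generator. The continuous linear maps
    [representing] and [unrep] carry the derivative in one equation to that in the other. *)
Lemma heisenberg_equiv eps (G : R -> fseries S -> fseries S) :
  0 < eps -> (forall t, is_pdo HA N W eps t (G t)) ->
  forall A : R -> forall n, cdual (S n),
  heisenberg TP N W eps A <->
  pseudodifferential_eq G (fun t => representing HA eps (A t)).
Proof.
move=> e0 GP A.
have GE t : G t (representing HA eps (A t)) = representing HA eps (heisenberg_rhs eps t (A t)).
  rewrite (pdo_unique (GP t) (heisenberg_pdoP t e0)) /heisenberg_pdo.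
  apply: (congr1 (fun z : fseries S => representing HA eps z)).
  by apply: functional_extensionality_dep => n; rewrite /heisenberg_rhs representingK.
split=> H t n.
  rewrite GE; apply: (is_tderive_comp (Phi := fun F => representing HA eps F n)).
  - by move=> a x y; rewrite representing_lin.
  - exact: representing_continuous.
  - exact: H.
have := is_tderive_comp (Phi := fun F => unrep eps F n) _ _ (H t).
rewrite GE representingK // /heisenberg_rhs.
under [X in is_tderive X]eq_fun do rewrite representingK //.
apply; first by move=> a x y; rewrite unrep_lin.
exact: unrep_continuous.
Qed.

End Representation.

(** * The limit as [eps] tends to 0 *)

Section Limit.
Variables (R : realType) (L : tvsType R) (HA : hamiltonian_algebra L)
  (S : symmetric_powers L).
Variables (N : option nat) (W : R -> forall n, cdual (S n)).
Local Notation C := (R[i]).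

(** The symbol as a polynomial in [eps]; its constant coefficient is the symbol of the Vlasov
    operator. *)
Definition symbol_poly t (A : cdual L) p r : {poly C} :=
  \poly_(k < p.+1) (- ('C(p, k)%:R * (p.+1%:R *
    mext (gamma_series N W t p.+1)
      (prebr HA r A :: nseq k (premul HA r A) ++ nseq (p - k) (r, 0))))).

Lemma symbol_polyE eps t A p r : Gsymbol HA N W eps t p r A = (symbol_poly t A p r).[eps%:C].
Proof.
rewrite /Gsymbol pairC_prebr hbr_anti_at -pairC_prebr pairC_delta_series -cat1s.
rewrite (symform_binom (t := eps%:C) (a := (r, 0)) (b := premul HA r A)
  (symform_mext _)) //; last first.
  by move=> B; rewrite pairC_real !pairC_premul hmul_line.
rewrite horner_poly mulr_sumr -sumrN; apply: eq_bigr => k _ /=; ring.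
Qed.

Definition exp_poly t (A : cdual L) n r : {poly C} :=
  \sum_(p < n) expseq (A r) (n - p.+1) *: symbol_poly t A p r.

Lemma size_exp_poly t A n r : (size (exp_poly t A n r) <= n)%N.
Proof.
apply: (leq_trans (size_sum _ _ _)); apply/bigmax_leqP => p _.
apply: (leq_trans (size_scale_leq _ _)); apply: (leq_trans (size_poly _ _)).
exact: ltn_ord.
Qed.

Lemma pdo_exp_poly eps t G A n r : is_pdo HA N W eps t G ->
  G (exp_series S A) n (tens S (fun=> r)) = (exp_poly t A n r).[eps%:C].
Proof.
move=> [_ _ ->]; rewrite horner_sum; apply: eq_bigr => p _.
by rewrite hornerZ exp_series_diag symbol_polyE.
Qed.

Lemma vlasov_exp t A n r :
  vlasov_op HA N W t (exp_series S A) n r = (exp_poly t A n r).[0].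
Proof.
rewrite vlasov_opE horner_sum; apply: eq_bigr => p _.
rewrite hornerZ horner_coef0 coef_poly /= bin0 mul1r subn0 -[in RHS]pairC_delta_series.
rewrite -/(Hser N W t p (r, 0)) [in RHS]pairC_prebr -hbr_anti_at -pairC_prebr.
set m := (n - p.+1)%N; rewrite mextZ mext_etens /= ?size_nseq //.
(* The factor [m.+1] from differentiation reduces [m.+1!] to [m!]: an exponential is its own
   derivative up to the factor [A]. *)
rewrite big_cons big_nseq iter_mulr_1 pairC_real /expseq factS natrM invfM.
set q := pairC _ _; set f := m`!%:R^-1; set s := m.+1%:R.
have s0 : s != 0 by rewrite pnatr_eq0.
field. by [].
Qed.

Lemma vlasov_op_lin t n r a (x y : fseries S) :
  vlasov_op HA N W t (fun k => a *: x k + y k) n r =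
  a * vlasov_op HA N W t x n r + vlasov_op HA N W t y n r.
Proof.
rewrite !vlasov_opE mulr_sumr -big_split; apply: eq_bigr => p _ /=.
rewrite mextD mextZ; ring.
Qed.

Lemma vlasov_op_continuous t n r :
  continuous (fun x : fseries S => vlasov_op HA N W t x n r : R[i]^o).
Proof.
have -> : (fun x : fseries S => vlasov_op HA N W t x n r : R[i]^o) =
    fun x => \sum_(p < n) (n - p.+1).+1%:R * mext (x (n - p.+1).+1)
      (prebr HA r (Hser N W t p (r, 0)) :: nseq (n - p.+1) (r, 0)).
  by apply/funext => x; rewrite vlasov_opE.
apply: continuous_sum => p; apply: continuous_mull => x.
set k := (n - p.+1).+1; set s := _ :: _.
apply: (@cvg_comp _ _ _ (fun x : fseries S => x k) (fun V => mext V s : R[i]^o)).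
  exact: fseries_proj_continuous.
exact: mext_continuous.
Qed.

(** The nodes start at 1 because [G] is a prescribed operator only for positive [eps]. *)
Let node (i : nat) : R := i.+1%:R.

(* On an exponential, the degree n part of G is a polynomial in eps of degree
   less than n; interpolating at fixed nodes makes it one for every alpha. *)
Lemma pdo_interpolation (G : R -> R -> fseries S -> fseries S) t n r :
  (forall eps t, 0 < eps -> is_pdo HA N W eps t (G eps t)) ->
  exists l : 'I_n.+1 -> {poly C},
    (forall eps (x : fseries S), 0 < eps ->
      G eps t x n (tens S (fun=> r)) =
      (\sum_(i < n.+1) G (node i) t x n (tens S (fun=> r)) *: l i).[eps%:C]) /\
    (forall x : fseries S,
      vlasov_op HA N W t x n r =
      (\sum_(i < n.+1) G (node i) t x n (tens S (fun=> r)) *: l i).[0]).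
Proof.
move=> GP.
pose e (i : nat) : C := (node i)%:C.
have e_inj : injective e.
  move=> i j /complexI /eqP; rewrite /node eqr_nat eqSS => /eqP. exact.
have node0 i : 0 < node i by rewrite ltr0Sn.
pose l (i : 'I_n.+1) : {poly C} := tnth (lagrange n.+1 e) i.
have lP (p : {poly C}) : (size p <= n.+1)%N -> p = \sum_(i < n.+1) p.[e i] *: l i.
  move=> ps; rewrite {1}(lagrange_gen (ltn0Sn n) e_inj ps).
  by apply: eq_bigr => i _; rewrite mul_polyC.
(* [Q x] interpolates the values at the nodes. On exponentials it reproduces the exact polynomial,
   and totality extends both identities to every series. *)
pose Q (x : fseries S) := \sum_(i < n.+1) G (node i) t x n (tens S (fun=> r)) *: l i.
have Qexp A : Q (exp_series S A) = exp_poly t A n r.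
  rewrite [RHS]lP; last exact: leq_trans (size_exp_poly _ _ _ _) (leqnSn n).
  by apply: eq_bigr => i _; rewrite (pdo_exp_poly _ _ _ (GP _ t (node0 i))).
have Qlin z a (x y : fseries S) : (Q (fun k => a *: x k + y k)).[z] = a * (Q x).[z] + (Q y).[z].
  rewrite !horner_sum mulr_sumr -big_split; apply: eq_bigr => i _ /=.
  rewrite !hornerZ (pdo_diag_lin _ _ (GP _ t (node0 i))); ring.
have Qcont z : continuous (fun x : fseries S => (Q x).[z] : R[i]^o).
  have -> : (fun x : fseries S => (Q x).[z] : R[i]^o) =
      fun x => \sum_(i < n.+1) (l i).[z] * G (node i) t x n (tens S (fun=> r)).
    apply/funext => x; rewrite horner_sum; apply: eq_bigr => i _.
    by rewrite hornerZ mulrC.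
  apply: continuous_sum => i; apply: continuous_mull.
  exact: pdo_diag_continuous (GP _ t (node0 i)).
exists l; split=> [eps x e0|x]; apply/eqP; rewrite -subr_eq0 -mulN1r; apply/eqP.
  apply: (@exp_series_total _ _ S
    (fun x => G eps t x n (tens S (fun=> r)) + -1 * (Q x).[eps%:C])) => [a y z| |A].
  - rewrite (pdo_diag_lin _ _ (GP _ t e0)) Qlin; ring.
  - apply: continuous_add; first exact: pdo_diag_continuous (GP _ t e0).
    exact: continuous_mull.
  - by rewrite (pdo_exp_poly _ _ _ (GP _ t e0)) Qexp mulN1r subrr.
apply: (@exp_series_total _ _ S
  (fun x => vlasov_op HA N W t x n r + -1 * (Q x).[0])) => [a y z| |A].
- rewrite vlasov_op_lin Qlin; ring.
- apply: continuous_add; first exact: vlasov_op_continuous.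
  exact: continuous_mull.
- by rewrite vlasov_exp Qexp mulN1r subrr.
Qed.

(** For [eps > 0] the coefficient is one fixed polynomial in [eps], whose value at 0 is the Vlasov
    term; continuity of polynomials concludes. *)
Lemma pdo_limit (G : R -> R -> fseries S -> fseries S) :
  (forall eps t, 0 < eps -> is_pdo HA N W eps t (G eps t)) ->
  forall t (alpha : fseries S) n r,
    (G eps t alpha n (tens S (fun=> r)) : R[i]^o) @[eps --> 0^'+] -->
    (vlasov_op HA N W t alpha n r : R[i]^o).
Proof.
move=> GP t alpha n r; have [l [lG lV]] := pdo_interpolation t n r GP.
rewrite lV; set q := \sum_i _.
have : (q.[eps%:C] : R[i]^o) @[eps --> (0:R)^'+] --> (q.[(0:R)%:C] : R[i]^o).
  apply: cvg_within_filter; exact: horner_real_continuous.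
rewrite rmorph0; apply: cvg_trans; apply: near_eq_cvg; near=> eps.
by rewrite lG.
Unshelve. all: by end_near. Qed.
End Limit.

(** * Equivalence of the equations, the limit, and the weak Vlasov equation *)

Theorem proposition3 (R : realType) (L : tvsType R) (HL : frechet L)
  (HA : hamiltonian_algebra L) (Ln : symmetric_powers L)
  (TP : tensor_products HA Ln)
  (N : option nat) (W : R -> forall n : nat, cdual (Ln n))
  (Wreal : forall (t : R) (n : nat) (x : Ln n),
     in_range N n -> W t n x \is Num.real) :
  (* H(t, rho . (I + eps A)) = exp{eps <rho, delta . A>} H(t, rho) *)
  (forall (eps t : R) (p : nat) (r : L) (A : cdual L) (sigma : L) (K : nat),
     0 < eps -> (p <= K)%N ->
     Hser N W t p (premul HA r (hone HA + eps%:C *: A)) sigma =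
     \sum_(k < K.+1) eps%:C ^+ k / k`!%:R *
       iter k (delta_dir HA r A) (fun z => Hser N W t p z sigma) (r, 0)) /\
  (* the operator of the pseudodifferential equation is well defined *)
  (forall eps t : R, 0 < eps -> exists! G, is_pdo HA N W eps t G) /\
  (* the Heisenberg system is equivalent to the pseudodifferential equation *)
  (forall (eps : R) (G : R -> fseries Ln -> fseries Ln),
     0 < eps -> (forall t, is_pdo HA N W eps t (G t)) ->
     forall A : R -> forall n : nat, cdual (Ln n),
       heisenberg TP N W eps A <->
       pseudodifferential_eq G (fun t => representing HA eps (A t))) /\
  (* limit of the pseudodifferential equation *)
  (forall G : R -> R -> fseries Ln -> fseries Ln,
     (forall eps t, 0 < eps -> is_pdo HA N W eps t (G eps t)) ->
     forall (t : R) (alpha : fseries Ln) (n : nat) (r : L),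
       (G eps t alpha n (tens Ln (fun=> r)) : R[i]^o) @[eps --> 0^'+] -->
       (vlasov_op HA N W t alpha n r : R[i]^o)) /\
  (* the limit equation on linear functionals: weak form of the Vlasov
     equation *)
  (forall (t : R) (A : cdual L) (p : nat) (r : L),
     vlasov_op HA N W t (linear_series Ln A) p.+1 r =
     pairC (prebr HA r (Hser N W t p (r, 0))) A) /\
  (forall (rho : R -> L) (Hrho : R -> cdual L),
     (forall t, series (fun p => Hser N W t p (rho t, 0)) @ \oo --> Hrho t) ->
     forall A : cdual L,
       (forall t,
          (series (fun n => vlasov_op HA N W t (linear_series Ln A) n (rho t))
             : nat -> R[i]^o) @ \oo -->
          (pairC (prebr HA (rho t) (Hrho t)) A : R[i]^o)) /\
       ((forall t, exists2 l : R[i],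
           (series (fun n => vlasov_op HA N W t (linear_series Ln A) n (rho t))
              : nat -> R[i]^o) @ \oo --> (l : R[i]^o) &
           @is_tderive R (R[i]^o : tvsType R[i]) (fun s => A (rho s)) t l) <->
        (forall t,
           @is_tderive R (R[i]^o : tvsType R[i]) (fun s => A (rho s)) t
             (pairC (prebr HA (rho t) (Hrho t)) A)))).

Proof.
split; first by move=> eps t p r A sigma K _; exact: symbol_hamiltonian.
split.
  move=> eps t e0; exists (heisenberg_pdo TP N W eps t); split.
    exact: heisenberg_pdoP.
  by move=> G; apply: pdo_unique; exact: heisenberg_pdoP.
split; first by move=> eps G; exact: heisenberg_equiv.
split; first by move=> G; exact: pdo_limit.
split; first by move=> t A p r; exact: vlasov_op_linear.
move=> rho Hrho cH A.
have cV t := vlasov_series (HA := HA) (A := A) (cH t).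
split=> //; split=> H t; last by exists (pairC (prebr HA (rho t) (Hrho t)) A).
have [l cl fl] := H t.
have hC : hausdorff_space (R[i]^o : topologicalType) by exact: norm_hausdorff.
(* Uniqueness of limits identifies the sum [l] with the Vlasov pairing. *)
by rewrite (@cvg_unique _ hC _ _ _ _ (cV t) cl).
Qed.
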